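(* Suppose that $$\operatorname{trace}(\Sigma^{(0)})\le\sup\{\operatorname{trace}(X): X\in W\}<\infty.$$ Then there exists a constant $C_{\mathrm{FPI}}>0$, independent of $\delta,\tau_\Sigma,\tau_G$, such that if $\tau_\Sigma,\tau_G$ satisfy $$\tau_\Sigma+C_{\mathrm{FPI}}\frac{\tau_G}{\delta^3}<1,$$ then the regularized fixed-point iteration $$m^{(k+1)}=\frac{(\mathbf f,D_\alpha\mathbf f)_{\delta I+\Sigma^{(k)}}}{\|\mathbf f\|^2_{\delta I+\Sigma^{(k)}}},\qquad \Sigma^{(k+1)}=\operatorname{proj}_W\big(\tau_\Sigma\Sigma^{(k)}+\tau_G\,G(m^{(k+1)})\big),\qquad k=0,1,2,\dots,$$ started at the Hermitian matrix $\Sigma^{(0)}$, converges to a unique fixed point.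
   Context: Let $d\ge 1$, let $u_1,\dots,u_n\in L^2(\mathbb{R}^d)$ be linearly independent complex-valued functions supported in the unit cube of $\mathbb{R}^d$, and let $f_1,\dots,f_n$ be their Fourier transforms (real-analytic on $\mathbb{R}^d$). Let $V$ be the space of their complex linear combinations. Let $\Omega_0\subset\mathbb{R}^d$ be compact with non-empty interior. Let $\alpha>1$, $D_\alpha v(\xi)=v(\alpha\xi)$, $\mathbf f=(f_1,\dots,f_n)^T$ and $D_\alpha\mathbf f=(D_\alpha f_1,\dots,D_\alpha f_n)^T$. For a positive semidefinite Hermitian matrix $A\in\mathbb{C}^{n\times n}$ and $\mathbf x,\mathbf y\in\mathbb{C}^n$ write $(\mathbf x,\mathbf y)_A=\mathbf x^*A\mathbf y$ and $\|\mathbf x\|_A^2=(\mathbf x,\mathbf x)_A$; the quotient defining $m^{(k+1)}$ is taken pointwise on $\Omega_0$. The parameters satisfy $\delta,\tau_\Sigma,\tau_G>0$, and $I$ is the $n\times n$ identity. Let $\mu$ be a measure on $\mathbb{R}^d$ for which there exist constants $c_\mu,C_\mu>0$ with $c_\mu\|v\|_{L^2}^2\le\int|v(\xi)|^2\,d\mu(\xi)\le C_\mu\|v\|_{L^2}^2$ for all $v\in V$. Let $\mathbb{H}^{n\times n}$ be the real Hilbert space of $n\times n$ Hermitian matrices with inner product $\langle X,Y\rangle_F=\operatorname{Re}\operatorname{trace}(X^*Y)$. For $m\in L^2(\Omega_0)$ let $$G(m)=\frac12\int_{\Omega_0}(D_\alpha\mathbf f(\xi)-m(\xi)\mathbf f(\xi))(D_\alpha\mathbf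 f(\xi)-m(\xi)\mathbf f(\xi))^*\,d\mu(\xi)\in\mathbb{H}^{n\times n}.$$ $W\subset\mathbb{H}^{n\times n}$ is a convex compact set containing the origin and invariant under unitary conjugations: $U^*XU\in W$ for all $X\in W$ and all unitary $U$. Hence $W=\{U\operatorname{diag}(\mathbf d)U^*:\mathbf d\in D_W,\ U\text{ unitary}\}$ for a set $D_W\subset\mathbb{R}^n$ invariant under permutations; it is assumed that $D_W$ is convex and orthosymmetric, i.e. $\operatorname{diag}(\mathbf s)\mathbf d\in D_W$ for all $\mathbf d\in D_W$ and $\mathbf s\in\{-1,1\}^n$. $\operatorname{proj}_W$ is the orthogonal projection onto $W$ with respect to $\langle\cdot,\cdot\rangle_F$.
   Formalization: The constant C_FPI serves all δ up to an arbitrary fixed bound δ_max, since one constant for all δ>0 fails as δ→∞; also δI+Σ^(0) is positive definite, D_α f_i is in L²(Ω_0,μ), and uniqueness is among fixed points with δI+Σ positive definite. *)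

(* Defs.v *)
From HB Require Import structures.
From mathcomp Require Import all_boot all_order perm all_algebra.
From mathcomp Require Import complex.
From mathcomp Require Import all_classical all_reals all_analysis measurable_realfun.

Set Implicit Arguments.
Unset Strict Implicit.
Unset Printing Implicit Defensive.

Import Order.TTheory GRing.Theory Num.Theory.
Import numFieldNormedType.Exports.

Local Open Scope classical_set_scope.
Local Open Scope ring_scope.
Local Open Scope complex_scope.
Local Open Scope sesquilinear_scope.

Definition rV_display : measure_display. Proof. exact: default_measure_display. Qed.

HB.instance Definition _ (R : realType) (d : nat) :=
  @isMeasurable.Build rV_display 'rV[R]_d <<s @open 'rV[R]_d >>
    (@sigma_algebra0 _ setT _) (@sigma_algebraC _ _)
    (@sigma_algebra_bigcup _ setT _).

Section borel_rV.
Context {R : realType}.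

Definition rat_box n (p : 'rV[rat]_n * nat) : set 'rV[R]_n :=
  \bigcap_(i in [set: 'I_n])
    [set v | `|v 0 i - ratr (p.1 0 i)| < p.2.+1%:R^-1].

Lemma open_rat_box n (U : set 'rV[R]_n) : open U ->
  U = \bigcup_(p in [set p | rat_box p `<=` U]) rat_box p.
Proof.
move=> oU; apply/seteqP; split => [x Ux|x [p pU]]; last exact: pU.
have /nbhs_ballP[e /= e0 xeU] : nbhs x U by exact: open_nbhs_nbhs.
have [k ke] : exists k : nat, k.+1%:R^-1 < e / 2.
  have e20 : 0 < e / 2 by rewrite divr_gt0.
  near \oo => k; exists k; near: k; exact: near_infty_natSinv_lt (PosNum e20).
have dq i : exists q : rat, `|x 0 i - ratr q| < k.+1%:R^-1.
  have [|q] := @rat_in_itvoo R (x 0 i - k.+1%:R^-1) (x 0 i + k.+1%:R^-1).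
    by rewrite ltrD2l gtrN.
  rewrite in_itv/= => /andP[h1 h2]; exists q.
  by rewrite distrC ltr_distl h1 h2.
have [q Pq] := choice dq.
exists (\row_i q i, k) => /=.
- move=> v /= vq; apply: xeU; split=> // i j; rewrite (ord1 i).
  have := vq j Logic.I; rewrite /= !mxE /ball/= distrC => h.
  rewrite (splitr e) -(subrKA (ratr (q j))) (le_lt_trans (ler_normD _ _))//.
  by rewrite ltrD// (lt_trans _ ke).
- by move=> i _ /=; rewrite !mxE.
Unshelve. all: by end_near. Qed.

Lemma measurable_fun_rowP d (T : measurableType d) n (h : T -> 'rV[R]_n) :
  (forall i, measurable_fun setT (fun x => h x 0 i)) -> measurable_fun setT h.
Proof.
move=> mh; apply: (@measurability _ _ T 'rV[R]_n setT h open) => //.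
move=> _ [U /open_rat_box -> <-]; rewrite setTI preimage_bigcup.
rewrite bigcup_mkcond; apply: countable_bigcupT_measurable => [|p].
  exact: countableP.
case: ifPn => // _; rewrite /rat_box preimage_bigcap.
apply: fin_bigcap_measurable => // i _.
have mB : measurable (ball (ratr (p.1 0 i) : R) p.2.+1%:R^-1).
  by apply: open_measurable; apply: ball_open.
have := mh i measurableT _ mB; rewrite setTI; congr measurable.
by apply/seteqP; split=> x /=; rewrite /ball/= distrC.
Qed.

Lemma measurable_coord_rV n (i : 'I_n) :
  measurable_fun setT (fun v : 'rV[R]_n => v 0 i).
Proof.
apply: (measurability _ (RGenOInfty.measurableE R)) => _ [_ [x ->] <-].
rewrite setTI; apply: sub_sigma_algebra.
have /continuousP := @coord_continuous R 1 n 0 i; apply.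
exact: interval_open.
Qed.

End borel_rV.

Section lebesgue_rV.
Context {R : realType}.

Definition consrV n (p : R * 'rV[R]_n) : 'rV[R]_n.+1 := row_mx (p.1)%:M p.2.

Definition unconsrV n (v : 'rV[R]_n.+1) : R * 'rV[R]_n :=
  (v 0 0, \row_j v 0 (lift 0 j)).

Lemma consrV0 n x (v : 'rV[R]_n) : consrV (x, v) 0 0 = x.
Proof.
rewrite /consrV/= (_ : 0 = lshift n 0 :> 'I_(1 + n)); last exact/val_inj.
by rewrite (@row_mxEl _ 1 1 n) mxE eqxx mulr1n.
Qed.

Lemma consrVS n x (v : 'rV[R]_n) j : consrV (x, v) 0 (lift 0 j) = v 0 j.
Proof.
rewrite /consrV/= (_ : lift 0 j = rshift 1 j :> 'I_(1 + n)); last exact/val_inj.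
by rewrite (@row_mxEr _ 1 1 n).
Qed.

Lemma consrVK n : cancel (@consrV n) (@unconsrV n).
Proof.
move=> [x v]; congr pair; first exact: consrV0.
by apply/rowP => j; rewrite mxE consrVS.
Qed.

Lemma measurable_consrV n : measurable_fun setT (@consrV n).
Proof.
apply: measurable_fun_rowP => i; have [j ->|->] := unliftP 0 i.
- rewrite (_ : (fun _ => _) = (fun v : 'rV[R]_n => v 0 j) \o snd).
    exact: (measurableT_comp (measurable_coord_rV j) measurable_snd).
  by apply/funext => -[x v]; exact: consrVS.
- rewrite (_ : (fun _ => _) = fst); first exact: measurable_fst.
  by apply/funext => -[x v]; exact: consrV0.
Qed.

Lemma measurable_unconsrV n : measurable_fun setT (@unconsrV n).
Proof.
apply: measurable_fun_pair => /=; first exact: measurable_coord_rV.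
apply: measurable_fun_rowP => i; under eq_fun do rewrite mxE.
exact: measurable_coord_rV.
Qed.

HB.instance Definition _ n :=
  isMeasurableFun.Build _ _ _ _ (@consrV n) (@measurable_consrV n).

Section lebesgue_step.
Variables (n : nat) (m : {sigma_finite_measure set 'rV[R]_n -> \bar R}).

Definition lebesgue_step := pushforward (lebesgue_measure \x m)%E (@consrV n).

Let step0 : lebesgue_step set0 = 0%E.
Proof. by apply: measure0; exact: measurable_consrV. Qed.

Let step_ge0 A : (0 <= lebesgue_step A)%E.
Proof. by apply: measure_ge0; exact: measurable_consrV. Qed.

Let step_sigma_additive : semi_sigma_additive lebesgue_step.
Proof. by apply: measure_semi_sigma_additive; exact: measurable_consrV. Qed.

HB.instance Definition _ := isMeasure.Build _ _ _ lebesgue_step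
  step0 step_ge0 step_sigma_additive.

Let step_sigma_finite : sigma_finite setT lebesgue_step.
Proof.
have /sigma_finiteP[F [FT ndF Foo]] := sigma_finiteT (@lebesgue_measure R).
have /sigma_finiteP[G [GT ndG Goo]] := sigma_finiteT m.
exists (fun k => @unconsrV n @^-1` (F k `*` G k)) => [|k].
  rewrite -preimage_bigcup -[LHS](preimage_setT (@unconsrV n)); congr preimage.
  rewrite -setXTT FT GT predeqE => -[x y]; split.
    move=> [/= [i _ Fx] [j _ Gy]]; exists (maxn i j) => //; split.
      by move: x Fx; exact/subsetPset/ndF/leq_maxl.
    by move: y Gy; exact/subsetPset/ndG/leq_maxr.
  by move=> [i _ []/= ? ?]; split; exists i.
have [mF Fk] := Foo k; have [mG Gk] := Goo k; split.
  rewrite -[X in measurable X]setTI; apply: measurable_unconsrV => //.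
  exact: measurableX.
rewrite /lebesgue_step /pushforward (_ : _ @^-1` _ = F k `*` G k).
  by rewrite product_measure1E// lte_mul_pinfty// ge0_fin_numE.
by apply/funext => p; rewrite /preimage /mkset consrVK; case: p.
Qed.

HB.instance Definition _ := Measure_isSigmaFinite.Build _ _ _ lebesgue_step
  step_sigma_finite.

End lebesgue_step.

Fixpoint lebesgue_rV d : {sigma_finite_measure set 'rV[R]_d -> \bar R} :=
  match d with
  | 0 => dirac (0 : 'rV[R]_0)
  | d'.+1 => lebesgue_step (lebesgue_rV d')
  end.

Lemma lebesgue_rV_box d (A : 'I_d -> set R) : (forall i, measurable (A i)) ->
  lebesgue_rV d [set v | forall i, A i (v 0 i)] =
  (\prod_(i < d) lebesgue_measure (A i))%E.
Proof.
elim: d A => [|d IH] A mA.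
  rewrite big_ord0 /= /dirac/= indicE mem_set//=; by case.
rewrite big_ord_recl /= /lebesgue_step /pushforward -(IH (fun i => A (lift 0 i)))//.
rewrite -product_measure1E//.
- congr (product_measure1 _ _ _); apply/funext => -[x v]; apply/propext.
  split=> [h|[/= h0 hS] i].
    by split => /= [|i]; [move: (h 0); rewrite consrV0|move: (h (lift 0 i)); rewrite consrVS].
  by have [j ->|->] := unliftP 0 i; rewrite ?consrV0 ?consrVS.
- exact: mA.
- rewrite [X in measurable X](_ : _ = \bigcap_(i in [set: 'I_d])
    (fun v : 'rV[R]_d => v 0 i) @^-1` A (lift 0 i)).
  apply: fin_bigcap_measurable => // i _.
  by rewrite -[X in measurable X]setTI; exact: measurable_coord_rV.
by apply/seteqP; split=> v /= h i; [move=> _; exact: h|exact: h].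
Qed.

End lebesgue_rV.

Section complex_functions.
Context {R : realType}.
Local Notation C := R[i].

Section integrals.
Context d (T : measurableType d) (mu : {measure set T -> \bar R}).
Implicit Types (D : set T) (g v : T -> C).

Definition cmeasurable_fun D g : Prop :=
  measurable_fun D (fun x => complex.Re (g x)) /\
  measurable_fun D (fun x => complex.Im (g x)).

Definition Cintegral D g : C :=
  (\int[mu]_(x in D) complex.Re (g x)) +i* (\int[mu]_(x in D) complex.Im (g x)).

Definition sqr_L2norm D v : \bar R :=
  (\int[mu]_(x in D) (Normc.normc (v x) ^+ 2)%:E)%E.

Definition in_L2 D v : Prop :=
  cmeasurable_fun D v /\ (sqr_L2norm D v < +oo)%E.

End integrals.

Section euclidean.
Variable d : nat.
Local Notation E := 'rV[R]_d.

Definition unit_cube : set E := [set x | forall i, 0 <= x 0 i <= 1].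

Definition supported_in (A : set E) (u : E -> C) : Prop :=
  {ae lebesgue_rV d, forall x, ~ A x -> u x = 0}.

(** Linear independence in L^2, i.e. of the classes modulo a.e. equality. *)
Definition L2_linearly_independent n (u : 'I_n -> E -> C) : Prop :=
  forall c : 'I_n -> C,
    {ae lebesgue_rV d, forall x, \sum_(i < n) c i * u i x = 0} ->
    forall i, c i = 0.

Definition dotrV (x y : E) : R := \sum_(i < d) x 0 i * y 0 i.

Definition expi (t : R) : C := cos t +i* sin t.

Definition fourier (u : E -> C) : E -> C := fun xi =>
  Cintegral (lebesgue_rV d) setT (fun x => u x * expi (- (2 * pi * dotrV x xi))).

Definition dilate (alpha : R) (v : E -> C) : E -> C := fun xi => v (alpha *: xi).

End euclidean.
End complex_functions.

Section hermitian.
Context {R : realType}.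
Local Notation C := R[i].
Variable n : nat.
Local Notation M := 'M[C]_n.

Definition form_mx (A : M) (x y : 'cV[C]_n) : C := (x ^t* *m A *m y) 0 0.

(** The order of [R[i]] makes [0 < z] include that [z] is real. *)
Definition posdefmx (A : M) : Prop :=
  A \is hermsymmx /\ forall x : 'cV[C]_n, x != 0 -> 0 < form_mx A x x.

Definition frob_inner (X Y : M) : R := complex.Re (\tr (X ^t* *m Y)).

Definition frob_norm (X : M) : R := Num.sqrt (frob_inner X X).

Definition is_proj (W : set M) (X Y : M) : Prop :=
  W Y /\ forall Z, W Z -> frob_norm (X - Y) <= frob_norm (X - Z).

(** The value is junk when no nearest point exists, which does not happen for
    the non-empty compact convex [W] considered here. *)
Definition proj (W : set M) (X : M) : M := xget 0 [set Y | is_proj W X Y].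

Definition real_diag (v : 'rV[R]_n) : M := diag_mx (map_mx (real_complex R) v).

Definition unitarily_invariant (W : set M) : Prop :=
  forall X U, W X -> U \is unitarymx -> W (U ^t* *m X *m U).

(** Segments of the *real* vector space of matrices. *)
Definition convex_mx (W : set M) : Prop :=
  forall X Y (t : R), W X -> W Y -> 0 <= t <= 1 ->
    W (t%:C *: X + (1 - t)%:C *: Y).

(** [R[i]^o] carries the topology of the complex numbers; matrices over it have
    the entrywise topology. *)
Definition compact_mx (W : set M) : Prop := compact (W : set 'M[C^o]_n).

Definition convex_rV (D : set 'rV[R]_n) : Prop :=
  forall v w (t : R), D v -> D w -> 0 <= t <= 1 -> D (t *: v + (1 - t) *: w).

Definition perm_invariant (D : set 'rV[R]_n) : Prop :=
  forall v (s : 'S_n), D v -> D (col_perm s v).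

Definition orthosymmetric (D : set 'rV[R]_n) : Prop :=
  forall v (s : 'rV[R]_n), D v -> (forall i, s 0 i = 1 \/ s 0 i = - 1) ->
    D (v *m diag_mx s).

End hermitian.

Section iteration.
Context {R : realType}.
Local Notation C := R[i].
Variables (d n : nat) (mu : {measure set 'rV[R]_d -> \bar R}).
Variables (Omega0 : set 'rV[R]_d) (alpha : R) (f : 'I_n -> 'rV[R]_d -> C).
Implicit Types (m : 'rV[R]_d -> C) (S : 'M[C]_n) (xi : 'rV[R]_d).

Definition fvec xi : 'cV[C]_n := \col_i f i xi.

Definition Dfvec xi : 'cV[C]_n := \col_i dilate alpha (f i) xi.

Definition residual m xi : 'cV[C]_n := Dfvec xi - m xi *: fvec xi.

Definition Gmx m : 'M[C]_n :=
  2^-1 *: \matrix_(i, j)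
    Cintegral mu Omega0 (fun xi => (residual m xi *m (residual m xi) ^t*) i j).

Section step.
Variables (delta tauS tauG : R) (W : set 'M[C]_n).

Definition regularized S : 'M[C]_n := delta%:C%:M + S.

(** When [fvec xi = 0] the quotient is [0 / 0 = 0]; the residual at [xi], hence
    [Gmx], does not depend on that value. *)
Definition m_update S : 'rV[R]_d -> C := fun xi =>
  form_mx (regularized S) (fvec xi) (Dfvec xi) /
  form_mx (regularized S) (fvec xi) (fvec xi).

Definition S_update m S : 'M[C]_n :=
  proj W (tauS%:C *: S + tauG%:C *: Gmx m).

Definition is_iteration (S0 : 'M[C]_n) (m : nat -> 'rV[R]_d -> C)
    (S : nat -> 'M[C]_n) : Prop :=
  S 0%N = S0 /\
  forall k, (forall xi, Omega0 xi -> m k.+1 xi = m_update (S k) xi) /\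
            S k.+1 = S_update (m k.+1) (S k).

Definition is_fixed_point m S : Prop :=
  (forall xi, Omega0 xi -> m xi = m_update S xi) /\ S = S_update m S.

(** The iteration started at [S0] converges and its limit is the only fixed
    point. Fixed points are sought where the form defining [m_update] is an
    inner product. Functions are identified when they agree on [Omega0]. *)
Definition converges_to_unique_fixed_point (S0 : 'M[C]_n) : Prop :=
  exists (ms : 'rV[R]_d -> C) (Ss : 'M[C]_n),
  [/\ posdefmx (regularized Ss) /\ is_fixed_point ms Ss,
      forall m' S', posdefmx (regularized S') -> is_fixed_point m' S' ->
        S' = Ss /\ forall xi, Omega0 xi -> m' xi = ms xi &
      forall (m : nat -> 'rV[R]_d -> C) (S : nat -> 'M[C]_n), is_iteration S0 m S ->
        frob_norm (S k - Ss) @[k --> \oo] --> (0 : R) /\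
        forall xi, Omega0 xi ->
          Normc.normc (m k xi - ms xi) @[k --> \oo] --> (0 : R)].

End step.
End iteration.

(* Main.v *)
Require Import Defs.
From mathcomp Require Import all_boot all_order all_algebra.
From mathcomp Require Import complex.
From mathcomp Require Import all_classical all_reals all_analysis.
From mathcomp Require Import measurable_realfun ring lra.

Import Order.TTheory GRing.Theory Num.Theory.
Import numFieldNormedType.Exports.

Local Open Scope classical_set_scope.
Local Open Scope ring_scope.
Local Open Scope complex_scope.
Local Open Scope sesquilinear_scope.

(** The iteration eliminates to the map
    [S |-> proj_W (tauS S + tauG G(m_S))] on matrices, where [m_S] is the
    weighted quotient. It is a contraction, for the Frobenius norm, on the
    matrices of [W] bounded below by [- (delta / 2) I], and every admissible
    orbit enters that set.

    Contraction. [m_S f] is the orthogonal projection of [D_alpha f] onto the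
    line of [f] for the inner product of the weight [A = delta I + S]. If
    [A >= l I] and the entries of [A] are at most [a], the residual [r_A] is at
    most [1 + n a / l] times [D_alpha f] ([wcoef_residual_bound]). For two
    weights [A] and [B], the orthogonality of [f] and [r_A] gives
    [(m_B - m_A) (f, f)_B = (f, r_A)_(B - A)], so the residuals differ by at most
    [n |A - B| / l] times [r_A] ([wcoef_residual_dist]). With [l = delta / 2] and
    [a] bounded because [W] is, integrating the outer products of the residuals
    shows that [G(m_S)] is Lipschitz in [S] with a constant [C / delta ^ 3],
    where [C] depends on [W], on the upper bound of delta and on the L2 norm of
    [D_alpha f] over [Omega0] ([Gmx_dist]). As the projection onto a convex set
    is nonexpansive, the step has Lipschitz constant
    [tauS + C tauG / delta ^ 3] ([step_contract]).

    Lower bounds. [G] is positive semidefinite, and projecting onto [W]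
    preserves a lower bound [- c I] with [c >= 0] ([form_ge_proj]): for the
    projection [Y = U diag(v) U^*] of [X], convexity and orthosymmetry allow
    zeroing a negative [v_i] inside [W], and the variational inequality then
    yields [u_i^* X u_i <= v_i]. Hence one step turns the bound [- c I] into
    [- tauS c I], and an orbit started where [delta I + S] is positive definite
    satisfies [S_k >= - tauS ^ k delta I] ([step_iterates_form_ge]). A fixed
    point is a constant orbit, so it is in the contraction region as well.

    Existence. Consecutive iterates of 0 approach each other geometrically, so
    any of their cluster points in the compact set [W] is fixed
    ([contraction_fixed_point]). *)

(** * Real and imaginary parts, modulus *)

Section complex_numbers.
Context {R : realType}.
Local Notation C := R[i].
Local Notation Re := (@complex.Re R).
Local Notation Im := (@complex.Im R).
Local Notation normc := (@Normc.normc R).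
Implicit Types x y z : C.

Lemma ReD x y : Re (x + y) = Re x + Re y.
Proof. by case: x y => ? ? []. Qed.

Lemma ImD x y : Im (x + y) = Im x + Im y.
Proof. by case: x y => ? ? []. Qed.

Lemma ReN x : Re (- x) = - Re x. Proof. by case: x. Qed.

Lemma ImN x : Im (- x) = - Im x. Proof. by case: x. Qed.

Lemma ReM x y : Re (x * y) = Re x * Re y - Im x * Im y.
Proof. by case: x y => ? ? []. Qed.

Lemma ImM x y : Im (x * y) = Re x * Im y + Im x * Re y.
Proof. by case: x y => ? ? []. Qed.

Lemma Re_conj x : Re x^* = Re x. Proof. by case: x. Qed.

Lemma Im_conj x : Im x^* = - Im x. Proof. by case: x. Qed.

Lemma conjCE x : Num.conj x = conjc x. Proof. by []. Qed.

Lemma Re_sum (I : Type) (r : seq I) (P : pred I) (F : I -> C) :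
  Re (\sum_(i <- r | P i) F i) = \sum_(i <- r | P i) Re (F i).
Proof. exact: (big_morph Re ReD (erefl : Re 0 = 0)). Qed.

Lemma Im_sum (I : Type) (r : seq I) (P : pred I) (F : I -> C) :
  Im (\sum_(i <- r | P i) F i) = \sum_(i <- r | P i) Im (F i).
Proof. exact: (big_morph Im ImD (erefl : Im 0 = 0)). Qed.

Lemma complexRI x y : Re x = Re y -> Im x = Im y -> x = y.
Proof. by case: x y => a b [c d] /= -> ->. Qed.

Lemma normcE x : `|x| = (normc x)%:C. Proof. by []. Qed.

Lemma normc_ge0 x : 0 <= normc x.
Proof. by rewrite -lecR -normcE normr_ge0. Qed.

Lemma normcD x y : normc (x + y) <= normc x + normc y.
Proof. by rewrite -lecR -normcE (le_trans (ler_normD _ _))// !normcE -rmorphD. Qed.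

Lemma normcN x : normc (- x) = normc x.
Proof. by apply: complexI; rewrite -!normcE normrN. Qed.

Lemma normcJ x : normc (Num.conj x) = normc x.
Proof. by case: x => a b; rewrite conjCE /= sqrrN. Qed.

Lemma sqr_normc x : normc x ^+ 2 = Re x ^+ 2 + Im x ^+ 2.
Proof. by case: x => a b /=; rewrite sqr_sqrtr// addr_ge0 ?sqr_ge0. Qed.

Lemma ler_normc x (b : R) : 0 <= b -> Re x ^+ 2 + Im x ^+ 2 <= b ^+ 2 -> normc x <= b.
Proof.
by move=> b0; rewrite -sqr_normc ler_sqr// ?nnegrE ?normc_ge0.
Qed.

Lemma ler_Re x : `|Re x| <= normc x.
Proof.
rewrite -ler_sqr ?nnegrE ?normc_ge0// sqr_normc real_normK ?num_real//.
by rewrite lerDl sqr_ge0.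
Qed.

Lemma ler_Im x : `|Im x| <= normc x.
Proof.
rewrite -ler_sqr ?nnegrE ?normc_ge0// sqr_normc real_normK ?num_real//.
by rewrite lerDr sqr_ge0.
Qed.

Lemma normc_sum (I : Type) (r : seq I) (P : pred I) (F : I -> C) :
  normc (\sum_(i <- r | P i) F i) <= \sum_(i <- r | P i) normc (F i).
Proof.
apply: (big_rec2 (fun z (b : R) => normc z <= b)) => [|i y1 y2 _ h]; first by rewrite Normc.normc0.
by rewrite (le_trans (normcD _ _))// lerD2l.
Qed.

Lemma normc_real (a : R) : normc a%:C = `|a|.
Proof. by rewrite /= expr0n addr0 sqrtr_sqr. Qed.

Lemma conj_mulE x : Re (Num.conj x * x) = normc x ^+ 2.
Proof. by rewrite conjCE ReM Re_conj Im_conj sqr_normc; ring. Qed.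

End complex_numbers.

(** * Vectors and sesquilinear forms *)

Section vectors_and_forms.
Context {R : realType}.
Local Notation C := R[i].
Local Notation Re := (@complex.Re R).
Local Notation Im := (@complex.Im R).
Local Notation normc := (@Normc.normc R).
Context {n : nat}.
Implicit Types (x y : 'cV[C]_n) (A B : 'M[C]_n).

Definition norm1 x : R := \sum_i normc (x i 0).

Definition sqnorm x : R := \sum_i normc (x i 0) ^+ 2.

Lemma norm1_ge0 x : 0 <= norm1 x.
Proof. by apply: sumr_ge0 => i _; exact: normc_ge0. Qed.

Lemma sqnorm_ge0 x : 0 <= sqnorm x.
Proof. by apply: sumr_ge0 => i _; exact: sqr_ge0. Qed.

Lemma sqnorm_gt0 x : x != 0 -> 0 < sqnorm x.
Proof.
move=> x0; rewrite lt_def sqnorm_ge0 andbT; apply: contra x0.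
rewrite psumr_eq0; last by move=> i _; exact: sqr_ge0.
move=> /allP h; apply/eqP/colP => i; rewrite mxE; apply: Normc.eq0_normc.
by apply/eqP; rewrite -sqrf_eq0; apply: h; rewrite mem_index_enum.
Qed.

Lemma normc_le_norm1 x i : normc (x i 0) <= norm1 x.
Proof.
by rewrite /norm1 (bigD1 i)//= lerDl sumr_ge0// => j _; exact: normc_ge0.
Qed.

Lemma norm1D x y : norm1 (x + y) <= norm1 x + norm1 y.
Proof.
by rewrite -big_split; apply: ler_sum => i _; rewrite mxE normcD.
Qed.

Lemma norm1N x : norm1 (- x) = norm1 x.
Proof. by apply: eq_bigr => i _; rewrite mxE normcN. Qed.

Lemma norm1Z c x : norm1 (c *: x) = normc c * norm1 x.
Proof. by rewrite mulr_sumr; apply: eq_bigr => i _; rewrite mxE Normc.normcM. Qed.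

(** The only comparison of vector norms in use: sizes are measured with the
    l1 norm, which bounds forms entrywise, while lower bounds of forms involve
    the squared Euclidean norm. *)
Lemma sqr_norm1_le x : norm1 x ^+ 2 <= n%:R * sqnorm x.
Proof.
rewrite expr2 mulr_suml.
under eq_bigr do rewrite mulr_sumr.
apply: (@le_trans _ _ (\sum_i \sum_(j < n)
   ((normc (x i 0) ^+ 2 + normc (x j 0) ^+ 2) / 2))).
  apply: ler_sum => i _; apply: ler_sum => j _.
  have := sqr_ge0 (normc (x i 0) - normc (x j 0)).
  by rewrite ler_pdivlMr//; lra.
rewrite le_eqVlt; apply/orP; left; apply/eqP.
under eq_bigr do rewrite -mulr_suml big_split/= sumr_const card_ord.
rewrite -mulr_suml big_split/= sumr_const card_ord -sumrMnl.
by rewrite sumrMnl -/(sqnorm x) -mulr_natl; field.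
Qed.

Lemma form_mxE A x y :
  form_mx A x y = \sum_i \sum_j Num.conj (x i 0) * A i j * y j 0.
Proof.
rewrite /form_mx mxE exchange_big/=; apply: eq_bigr => j _.
by rewrite mxE mulr_suml; apply: eq_bigr => i _; rewrite !mxE.
Qed.

Lemma form_mxDr A x y z : form_mx A x (y + z) = form_mx A x y + form_mx A x z.
Proof. by rewrite /form_mx mulmxDr mxE. Qed.

Lemma form_mxNr A x y : form_mx A x (- y) = - form_mx A x y.
Proof. by rewrite /form_mx mulmxN mxE. Qed.

Lemma form_mxZr A c x y : form_mx A x (c *: y) = c * form_mx A x y.
Proof. by rewrite /form_mx -scalemxAr mxE. Qed.

Lemma form_mxDm A B x y : form_mx (A + B) x y = form_mx A x y + form_mx B x y.
Proof. by rewrite /form_mx mulmxDr mulmxDl mxE. Qed.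

Lemma form_mxNm A x y : form_mx (- A) x y = - form_mx A x y.
Proof. by rewrite /form_mx mulmxN mulNmx mxE. Qed.

Lemma form_mxZm A c x y : form_mx (c *: A) x y = c * form_mx A x y.
Proof. by rewrite /form_mx -scalemxAr -scalemxAl mxE. Qed.

Lemma form_mx_scalar (c : R) x : form_mx c%:C%:M x x = (c * sqnorm x)%:C.
Proof.
apply: complexRI.
  rewrite form_mxE Re_sum mulr_sumr; apply: eq_bigr => i _.
  rewrite (bigD1 i)//= mxE eqxx mulr1n big1 ?addr0.
    rewrite -conj_mulE !ReM !ImM/=; ring.
  by move=> j /negPf ji; rewrite mxE eq_sym ji mulr0n mulr0 mul0r.
rewrite form_mxE Im_sum big1// => i _.
rewrite (bigD1 i)//= mxE eqxx mulr1n big1 ?addr0.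
  by rewrite !(ImM, ReM)/= conjCE Re_conj Im_conj; ring.
by move=> j /negPf ji; rewrite mxE eq_sym ji mulr0n mulr0 mul0r.
Qed.

Lemma form_mx_conj A x y : A \is hermsymmx ->
  Num.conj (form_mx A x y) = form_mx A y x.
Proof.
move=> /is_hermitianmxP; rewrite expr0 scale1r => hA.
rewrite !form_mxE rmorph_sum/= exchange_big/=; apply: eq_bigr => j _.
rewrite rmorph_sum/=; apply: eq_bigr => i _.
by rewrite !rmorphM/= conjCK {2}hA !mxE; ring.
Qed.

Lemma Im_form_mx A x : A \is hermsymmx -> Im (form_mx A x x) = 0.
Proof.
move=> /(form_mx_conj A x x) /(congr1 Im); rewrite conjCE Im_conj => h.
by apply/eqP; rewrite -[_ == _](mulrn_eq0 _ 2) mulr2n -{1}h addNr.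
Qed.

Lemma normc_form_mx A (a : R) x y : (forall i j, normc (A i j) <= a) ->
  normc (form_mx A x y) <= a * norm1 x * norm1 y.
Proof.
move=> Aa; rewrite form_mxE (le_trans (normc_sum _ _ _ _))//.
apply: (@le_trans _ _ (\sum_i \sum_j
   (normc (x i 0) * a * normc (y j 0)))).
  apply: ler_sum => i _; rewrite (le_trans (normc_sum _ _ _ _))//.
  apply: ler_sum => j _; rewrite !Normc.normcM normcJ.
  by rewrite ler_wpM2r ?normc_ge0// ler_wpM2l ?normc_ge0.
rewrite -mulrA mulrCA mulr_suml; apply: ler_sum => i _.
by rewrite mulrA mulr_sumr; apply: ler_sum => j _.
Qed.

(** The Loewner bound [c I <= A], stated for the real part of the form so that
    it makes sense, and adds up, for matrices not yet known to be Hermitian. *)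
Definition form_ge A (c : R) : Prop :=
  forall x, c * sqnorm x <= Re (form_mx A x x).

Lemma form_geW A c c' : c' <= c -> form_ge A c -> form_ge A c'.
Proof. by move=> cc h x; rewrite (le_trans _ (h x))// ler_wpM2r ?sqnorm_ge0. Qed.

Lemma form_ge0mx : form_ge 0 0.
Proof. by move=> x; rewrite /form_mx mulmx0 mul0mx mxE mul0r. Qed.

Lemma form_geD A B a b : form_ge A a -> form_ge B b -> form_ge (A + B) (a + b).
Proof. by move=> hA hB x; rewrite form_mxDm ReD mulrDl lerD. Qed.

Lemma form_geZ A a (t : R) : 0 <= t -> form_ge A a -> form_ge (t%:C *: A) (t * a).
Proof.
move=> t0 hA x; rewrite form_mxZm ReM/= mul0r subr0 -mulrA.
by rewrite ler_wpM2l.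
Qed.

Lemma form_ge_regularized A delta c :
  form_ge A c -> form_ge (regularized delta A) (delta + c).
Proof. by apply: form_geD => x; rewrite form_mx_scalar. Qed.

Lemma form_ge_regularized_half A delta :
  form_ge A (- (delta / 2)) -> form_ge (regularized delta A) (delta / 2).
Proof.
by move=> /(form_ge_regularized _ delta); rewrite [X in X - _ / _]splitr addrK.
Qed.

Lemma posdefmx_form_ge A c : 0 < c -> A \is hermsymmx -> form_ge A c -> posdefmx A.
Proof.
move=> c0 hA Ac; split => // x x0; rewrite ltcE (Im_form_mx _ _ hA) eqxx/=.
by rewrite (lt_le_trans _ (Ac x))// mulr_gt0// sqnorm_gt0.
Qed.

Lemma hermsymmx_regularized A delta :
  A \is hermsymmx -> regularized delta A \is hermsymmx.
Proof.
move=> /is_hermitianmxP hA; apply/is_hermitianmxP; move: hA.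
rewrite !expr0 !scale1r => hA; apply/matrixP => i j; rewrite !mxE.
rewrite [in LHS]hA !mxE rmorphD/= rmorphMn/= eq_sym; congr (_ *+ _ + _).
by rewrite conjCE /= oppr0.
Qed.

Lemma posdefmx_form_geN A delta :
  posdefmx (regularized delta A) -> form_ge A (- delta).
Proof.
move=> [_ hA] x; have [->|x0] := eqVneq x 0.
  have -> : sqnorm 0 = 0.
    by rewrite /sqnorm big1// => i _; rewrite mxE Normc.normc0 expr0n.
  by rewrite /form_mx !mulmx0 mxE mulr0.
have := hA x x0; rewrite ltcE /= => /andP[_].
rewrite form_mxDm ReD form_mx_scalar /= => /ltW; lra.
Qed.

End vectors_and_forms.

(** * The Frobenius norm *)

Section frobenius.
Context {R : realType} {n : nat}.
Local Notation C := R[i].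
Local Notation Re := (@complex.Re R).
Local Notation Im := (@complex.Im R).
Local Notation normc := (@Normc.normc R).
Local Notation M := 'M[C]_n.
Implicit Types (X Y Z : M) (t : R).

Lemma frob_innerE X Y : frob_inner X Y =
  \sum_i \sum_j (Re (X i j) * Re (Y i j) + Im (X i j) * Im (Y i j)).
Proof.
rewrite /frob_inner Re_sum exchange_big; apply: eq_bigr => j _.
rewrite mxE Re_sum; apply: eq_bigr => i _.
by rewrite !mxE conjCE ReM Re_conj Im_conj mulNr opprK.
Qed.

Lemma frob_innerC X Y : frob_inner X Y = frob_inner Y X.
Proof.
rewrite !frob_innerE; apply: eq_bigr => i _; apply: eq_bigr => j _; ring.
Qed.

Lemma frob_innerDr X Y Z : frob_inner X (Y + Z) = frob_inner X Y + frob_inner X Z.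
Proof. by rewrite /frob_inner mulmxDr raddfD ReD. Qed.

Lemma frob_innerNr X Y : frob_inner X (- Y) = - frob_inner X Y.
Proof. by rewrite /frob_inner mulmxN raddfN ReN. Qed.

Lemma frob_innerZr t X Y : frob_inner X (t%:C *: Y) = t * frob_inner X Y.
Proof. by rewrite /frob_inner -scalemxAr mxtraceZ ReM/= mul0r subr0. Qed.

Lemma frob_innerDl X Y Z : frob_inner (Y + Z) X = frob_inner Y X + frob_inner Z X.
Proof. by rewrite frob_innerC frob_innerDr !(frob_innerC X). Qed.

Lemma frob_innerNl X Y : frob_inner (- Y) X = - frob_inner Y X.
Proof. by rewrite frob_innerC frob_innerNr (frob_innerC X). Qed.

Lemma frob_innerZl t X Y : frob_inner (t%:C *: X) Y = t * frob_inner X Y.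
Proof. by rewrite frob_innerC frob_innerZr frob_innerC. Qed.

Lemma frob_inner_sqr X : frob_inner X X = \sum_i \sum_j normc (X i j) ^+ 2.
Proof.
rewrite frob_innerE; apply: eq_bigr => i _; apply: eq_bigr => j _.
by rewrite sqr_normc.
Qed.

Lemma frob_inner_ge0 X : 0 <= frob_inner X X.
Proof.
by rewrite frob_inner_sqr sumr_ge0// => i _; rewrite sumr_ge0// => j _; rewrite sqr_ge0.
Qed.

Lemma frob_norm_ge0 X : 0 <= frob_norm X.
Proof. exact: sqrtr_ge0. Qed.

Lemma sqr_frob_norm X : frob_norm X ^+ 2 = frob_inner X X.
Proof. by rewrite sqr_sqrtr// frob_inner_ge0. Qed.

Lemma normc_le_frob X i j : normc (X i j) <= frob_norm X.
Proof.
rewrite -ler_sqr ?nnegrE ?normc_ge0 ?frob_norm_ge0// sqr_frob_norm frob_inner_sqr.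
rewrite (bigD1 i)//= (bigD1 j)//= -addrA lerDl addr_ge0// ?sumr_ge0// => k _.
  exact: sqr_ge0.
by rewrite sumr_ge0// => l _; exact: sqr_ge0.
Qed.

Lemma frob_norm0_eq0 X : frob_norm X = 0 -> X = 0.
Proof.
move=> X0; apply/matrixP => i j; rewrite mxE; apply: Normc.eq0_normc.
by apply/eqP; rewrite eq_le normc_ge0 andbT -X0 normc_le_frob.
Qed.

Lemma frob_normN X : frob_norm (- X) = frob_norm X.
Proof. by rewrite /frob_norm frob_innerNl frob_innerNr opprK. Qed.

Lemma frob_distC X Y : frob_norm (X - Y) = frob_norm (Y - X).
Proof. by rewrite -frob_normN opprB. Qed.

Lemma frob_normZ t X : 0 <= t -> frob_norm (t%:C *: X) = t * frob_norm X.
Proof.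
move=> t0; rewrite /frob_norm frob_innerZl frob_innerZr mulrA -expr2.
by rewrite sqrtrM ?sqr_ge0// sqrtr_sqr ger0_norm.
Qed.

Lemma frob_cauchy_schwarz X Y : frob_inner X Y <= frob_norm X * frob_norm Y.
Proof.
have [Y0|Y0] := eqVneq (frob_norm Y) 0.
  by rewrite Y0 mulr0 (frob_norm0_eq0 _ Y0) /frob_inner mulmx0 mxtrace0.
have Ypos : 0 < frob_norm Y by rewrite lt_def Y0 frob_norm_ge0.
have := frob_inner_ge0 ((frob_norm Y ^+ 2)%:C *: X - (frob_inner X Y)%:C *: Y).
rewrite !(frob_innerDl, frob_innerDr, frob_innerNl, frob_innerNr, frob_innerZl, frob_innerZr).
rewrite (frob_innerC Y X) -!sqr_frob_norm => h.
rewrite (le_trans (ler_norm _))// -ler_sqr ?nnegrE ?mulr_ge0 ?frob_norm_ge0//.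
rewrite real_normK ?num_real// -(@ler_pM2l _ (frob_norm Y ^+ 2)) ?exprn_gt0//.
by rewrite -subr_ge0 (le_trans h)// le_eqVlt; apply/orP; left; apply/eqP; ring.
Qed.

Lemma frob_normD X Y : frob_norm (X + Y) <= frob_norm X + frob_norm Y.
Proof.
rewrite -ler_sqr ?nnegrE ?addr_ge0 ?frob_norm_ge0// sqr_frob_norm.
rewrite frob_innerDl !frob_innerDr (frob_innerC Y X) -!sqr_frob_norm.
have := frob_cauchy_schwarz X Y; lra.
Qed.

Lemma frob_dist_triangle Y X Z :
  frob_norm (X - Z) <= frob_norm (X - Y) + frob_norm (Y - Z).
Proof. by rewrite -{1}(subrK Y X) -addrA frob_normD. Qed.

Lemma frob_norm_le_sum X : frob_norm X <= \sum_i \sum_j normc (X i j).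
Proof.
have s0 : 0 <= \sum_i \sum_j normc (X i j).
  by rewrite sumr_ge0// => i _; rewrite sumr_ge0// => j _; rewrite normc_ge0.
rewrite -ler_sqr ?nnegrE ?frob_norm_ge0// sqr_frob_norm frob_inner_sqr.
rewrite expr2 mulr_suml; apply: ler_sum => i _.
rewrite mulr_suml; apply: ler_sum => j _; rewrite expr2.
rewrite ler_wpM2l ?normc_ge0// (bigD1 i)//= (bigD1 j)//= -addrA lerDl.
rewrite addr_ge0// ?sumr_ge0// => k _; first exact: normc_ge0.
by rewrite sumr_ge0// => l _; exact: normc_ge0.
Qed.

Lemma frob_norm_le_const X (b : R) : (forall i j, normc (X i j) <= b) ->
  frob_norm X <= n%:R ^+ 2 * b.
Proof.
move=> Xb; rewrite (le_trans (frob_norm_le_sum X))//.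
apply: (@le_trans _ _ (\sum_(i < n) \sum_(j < n) b)).
  by apply: ler_sum => i _; apply: ler_sum => j _.
by rewrite !sumr_const !card_ord -mulrnA -[b *+ _]mulr_natl natrM expr2.
Qed.

Lemma form_ge_perturb X Y (a e : R) : form_ge X a -> frob_norm (X - Y) <= e ->
  form_ge Y (a - n%:R * e).
Proof.
move=> Xa XYe x.
have h : normc (form_mx (X - Y) x x) <= n%:R * e * sqnorm x.
  have e0 : 0 <= e := le_trans (frob_norm_ge0 _) XYe.
  rewrite (le_trans (normc_form_mx (X - Y) e _ _ _))//.
    by move=> i j; rewrite (le_trans (normc_le_frob _ _ _)).
  by rewrite -mulrA -expr2 [n%:R * e]mulrC -mulrA ler_wpM2l// sqr_norm1_le.
have := le_trans (ler_norm _) (le_trans (ler_Re _) h).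
rewrite form_mxDm form_mxNm ReD ReN; have := Xa x; lra.
Qed.

Lemma form_ge_closed (a : R) Y :
  (forall e, 0 < e -> exists2 X, form_ge X a & frob_norm (X - Y) <= e) ->
  form_ge Y a.
Proof.
move=> near_Y x; apply/ler_addgt0Pr => e e0.
have s0 : 0 <= n%:R * sqnorm x by rewrite mulr_ge0// sqnorm_ge0.
have s1 : 0 < n%:R * sqnorm x + 1 by rewrite ltr_wpDl.
(* this perturbation of the matrix moves the form at x by at most e *)
have [|X Xa XY] := near_Y (e / (n%:R * sqnorm x + 1)); first by rewrite divr_gt0.
have := form_ge_perturb _ _ _ _ Xa XY x.
rewrite mulrBl lerBlDr => h; apply: le_trans h _; rewrite lerD2l.
rewrite mulrAC mulrA -ler_pdivlMr ?invr_gt0// invrK mulrC ler_pM2l//.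
by rewrite lerDl.
Qed.

(** The one place where the entrywise topology of complex matrices is related
    to the Frobenius norm; existence of projections, boundedness of [W] and
    existence of the fixed point all come from these cluster points. *)
Lemma compact_mx_cluster (W : set M) (S : nat -> M) :
  compact_mx W -> (forall k, W (S k)) ->
  exists2 Y, W Y & forall e : R, 0 < e -> forall N, exists2 k,
    (N <= k)%N & frob_norm (S k - Y) < e.
Proof.
move=> cW WS.
have [] := cW ((S : nat -> 'M[C^o]_n) @ \oo) _.
  by exists 0%N => // k _; exact: WS.
move=> Y [WY clY]; exists Y => // e e0 N.
have := clY [set X | exists2 k, (N <= k)%N & X = S k]
  [set X : 'M[C^o]_n | frob_norm ((X : M) - Y) < e].
case => //.
- by exists N => // k Nk; exists k.
- apply/nbhs_ballP; exists (e / (n%:R ^+ 2 + 1))%:C.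
    by rewrite /= ltcR divr_gt0// ltr_wpDl// exprn_ge0.
  move=> X /= [_ XY].
  have n1 : 0 < n%:R ^+ 2 + 1 :> R by rewrite ltr_wpDl// exprn_ge0.
  have : frob_norm ((X : M) - Y) <= n%:R ^+ 2 * (e / (n%:R ^+ 2 + 1)).
    apply: frob_norm_le_const => i j; rewrite !mxE.
    by have := XY i j; rewrite /ball /= normcE ltcR -normcN opprB => /ltW.
  move=> /le_lt_trans; apply.
  by rewrite mulrA ltr_pdivrMr// mulrC ltr_pM2l// ltrDl.
- by move=> X [[k Nk ->] /= h]; exists k.
Qed.

Lemma compact_mx_bounded (W : set M) : compact_mx W ->
  exists2 r, 0 < r & forall X, W X -> frob_norm X <= r.
Proof.
move=> cW; apply: contrapT => h.
have {}h (k : nat) : exists X, W X /\ k.+1%:R < frob_norm X.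
  apply: contrapT => nX; apply: h; exists k.+1%:R => // X WX.
  by rewrite leNgt; apply/negP => kX; apply: nX; exists X.
have [S SW] := choice h.
have [Y WY clY] := @compact_mx_cluster W S cW (fun k => (SW k).1).
have [k Nk] := clY 1 ltr01 (Num.truncn (frob_norm Y + 1)).+1.
have := (SW k).2; have := frob_normD (S k - Y) Y; rewrite subrK.
have : frob_norm Y + 1 < k%:R.
  by rewrite (lt_le_trans (truncnS_gt _))// ler_nat.
rewrite -natr1; lra.
Qed.

End frobenius.

(** * Unitary diagonalization *)

Section unitary_diagonalization.
Context {R : realType} {n : nat}.
Local Notation C := R[i].
Local Notation Re := (@complex.Re R).
Local Notation Im := (@complex.Im R).
Local Notation normc := (@Normc.normc R).
Local Notation M := 'M[C]_n.
Implicit Types (A X Y Z U : M) (v w : 'rV[R]_n).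

Lemma sqnormE (x : 'cV[C]_n) : (sqnorm x)%:C = form_mx 1%:M x x.
Proof. by rewrite -[1%:M]/((1 : R)%:C%:M) form_mx_scalar mul1r. Qed.

Lemma unitary_mul_tr U : U \is unitarymx -> U *m U ^t* = 1%:M.
Proof. by move/unitarymxP. Qed.

Lemma unitary_tr_mul U : U \is unitarymx -> U ^t* *m U = 1%:M.
Proof. by move/unitarymxP/mulmx1C. Qed.

Lemma form_mx_conjugate U X (x : 'cV[C]_n) :
  form_mx (U *m X *m U ^t*) x x = form_mx X (U ^t* *m x) (U ^t* *m x).
Proof.
rewrite /form_mx trmx_mul map_mxM; congr (_ 0 0).
by rewrite trmxCK !mulmxA.
Qed.

Lemma sqnorm_unitary U (x : 'cV[C]_n) : U \is unitarymx ->
  sqnorm (U ^t* *m x) = sqnorm x.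
Proof.
move=> Uu; apply: complexI; rewrite !sqnormE -form_mx_conjugate mulmx1.
by rewrite unitary_mul_tr.
Qed.

Lemma form_real_diag v (x : 'cV[C]_n) :
  Re (form_mx (real_diag v) x x) = \sum_i v 0 i * normc (x i 0) ^+ 2.
Proof.
rewrite form_mxE Re_sum; apply: eq_bigr => i _.
rewrite (bigD1 i)//= big1 ?addr0 => [|j /negPf ji].
  by rewrite !mxE eqxx mulr1n -conj_mulE !(ReM, ImM)/=; ring.
by rewrite !mxE eq_sym ji mulr0n mulr0 mul0r.
Qed.

Lemma form_ge_unitary_diag U v (c : R) : U \is unitarymx ->
  (forall i, c <= v 0 i) -> form_ge (U *m real_diag v *m U ^t*) c.
Proof.
move=> Uu cv x; rewrite form_mx_conjugate form_real_diag -(sqnorm_unitary U)//.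
by rewrite mulr_sumr; apply: ler_sum => i _; rewrite ler_wpM2r ?sqr_ge0.
Qed.

Lemma hermsymmx_diagonalize A : A \is hermsymmx ->
  exists U v, U \is unitarymx /\ A = U *m real_diag v *m U ^t*.
Proof.
move=> Ah; have /hermitian_normalmx/orthomx_spectralP A_eq := Ah.
have Pu := spectral_unitarymx A.
have /mxOverP dreal := hermitian_spectral_diag_real Ah.
rewrite (invmx_unitary Pu) in A_eq.
exists ((spectralmx A) ^t*), (map_mx Re (spectral_diag A)).
split; first by rewrite trmxC_unitary.
have -> : real_diag (map_mx Re (spectral_diag A)) = diag_mx (spectral_diag A).
  rewrite /real_diag -map_mx_comp; congr diag_mx; apply/rowP => i; rewrite mxE.
  have /CrealP /(congr1 Im) := dreal 0 i; rewrite conjCE Im_conj => h.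
  by apply: complexRI => //=; lra.
by rewrite trmxCK.
Qed.

(** Sampling a form at the columns of a unitary matrix reads off the diagonal
    of the conjugated matrix. *)
Lemma form_mx_col X U i :
  form_mx X (col i U) (col i U) = (U ^t* *m X *m U) i i.
Proof.
rewrite /form_mx !mxE; apply: eq_bigr => j _; rewrite !mxE; congr (_ * _).
by apply: eq_bigr => k _; rewrite !mxE.
Qed.

Lemma form_mx_unitary_diag_col U v i : U \is unitarymx ->
  form_mx (U *m real_diag v *m U ^t*) (col i U) (col i U) = (v 0 i)%:C.
Proof.
move=> Uu; rewrite form_mx_col !mulmxA unitary_tr_mul// mul1mx.
by rewrite -mulmxA unitary_tr_mul// mulmx1 !mxE eqxx mulr1n.
Qed.

Lemma sqnorm_col U i : U \is unitarymx -> sqnorm (col i U) = 1.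
Proof.
move=> Uu; apply: complexI; rewrite sqnormE form_mx_col mulmx1.
by rewrite unitary_tr_mul// mxE eqxx.
Qed.

Lemma frob_inner_unitary_diag X U v : U \is unitarymx ->
  frob_inner X (U *m real_diag v *m U ^t*) =
  \sum_i v 0 i * Re (form_mx X (col i U) (col i U)).
Proof.
move=> Uu; rewrite /frob_inner -[U *m _ *m _]mulmxA [X ^t* *m _]mulmxA mxtrace_mulC.
rewrite -mulmxA Re_sum; apply: eq_bigr => i _; rewrite form_mx_col.
have -> : U ^t* *m (X ^t* *m U) = (U ^t* *m X *m U) ^t*.
  by rewrite !trmx_mul !map_mxM trmxCK.
by rewrite mul_diag_mx !mxE ReM /= mul0r subr0 Re_conj.
Qed.

(** Positive definiteness is uniform: the smallest eigenvalue is a lower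
    bound. The minimum is taken with 1 as well, to cover dimension 0. *)
Lemma posdefmx_form_gt A : posdefmx A -> exists2 l : R, 0 < l & form_ge A l.
Proof.
move=> [/hermsymmx_diagonalize[U [v [Uu Ae]]] Apos].
have v0 i : 0 < v 0 i.
  have ci0 : col i U != 0.
    apply/eqP => h; have := sqnorm_col U i Uu; rewrite h /sqnorm big1 => [/esym/eqP|k _].
      by rewrite oner_eq0.
    by rewrite mxE Normc.normc0 expr0n.
  by have := Apos _ ci0; rewrite Ae form_mx_unitary_diag_col// ltcR.
exists (\big[Num.min/1]_i v 0 i); first by apply: lt_bigmin => // i _; exact: v0.
by rewrite Ae; apply: form_ge_unitary_diag => // i; exact: bigmin_le.
Qed.

End unitary_diagonalization.

(** * Projection onto a convex compact set *)

Lemma frob_norm_le {R : realType} {n : nat} (X Y : 'M[R[i]]_n) :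
  (frob_norm X <= frob_norm Y) = (frob_inner X X <= frob_inner Y Y).
Proof. by rewrite -!sqr_frob_norm ler_sqr ?nnegrE ?frob_norm_ge0. Qed.

(** These identities are proved for an abstract symmetric biadditive form; the
    Frobenius inner product is an instance. *)
Section real_inner_product.
Context {R : realType} {V : zmodType}.
Variables (ip : V -> V -> R) (scale : R -> V -> V).
Hypotheses (ipC : forall x y, ip x y = ip y x)
  (ipDr : forall x y z, ip x (y + z) = ip x y + ip x z)
  (ipNr : forall x y, ip x (- y) = - ip x y)
  (ipZr : forall t x y, ip x (scale t y) = t * ip x y).

Let ipDl x y z : ip (x + y) z = ip x z + ip y z.
Proof. by rewrite ipC ipDr !(ipC z). Qed.

Let ipNl x y : ip (- x) y = - ip x y.
Proof. by rewrite ipC ipNr (ipC y). Qed.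

(** If [p] and [q] are the projections of [x] and [y] on a convex set, the two
    hypotheses are their variational inequalities, tested against each other. *)
Lemma variational_monotone x y p q :
  ip (x - p) (q - p) <= 0 -> ip (y - q) (p - q) <= 0 ->
  ip (p - q) (p - q) <= ip (x - y) (p - q).
Proof.
rewrite !(ipDl, ipDr, ipNl, ipNr) (ipC q p); lra.
Qed.

Lemma sqr_sub_scale t x y : ip (x - scale t y) (x - scale t y) =
  ip x x + (t ^+ 2 * ip y y - 2 * t * ip x y).
Proof.
rewrite !(ipDl, ipDr, ipNl, ipNr, ipZr) !(ipC (scale t y)) !(ipDr, ipNr, ipZr) ?(ipC y x); ring.
Qed.

End real_inner_product.

Lemma le_of_sqr_le {R : realType} (a b : R) :
  0 <= a -> 0 <= b -> a ^+ 2 <= b * a -> a <= b.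
Proof.
rewrite le0r expr2 => /orP[/eqP -> //|a0] b0; by rewrite ler_pM2r.
Qed.

Section projection.
Local Notation proj := Defs.proj.
Context {R : realType} {n : nat}.
Local Notation C := R[i].
Local Notation Re := (@complex.Re R).
Local Notation M := 'M[C]_n.
Implicit Types (A X Y Z U : M) (v w : 'rV[R]_n).
Variable W : set M.
Hypotheses (W_convex : convex_mx W) (W_compact : compact_mx W) (W_0 : W 0).

Let approx_min (a b c i k f e : R) :
  a <= b + c -> b < i + k -> c < e / 2 -> k < e / 2 -> i <= f -> a <= f + e.
Proof. lra. Qed.

Let quadratic_le0 (a b : R) : 0 <= b ->
  (forall t, 0 <= t <= 1 -> 2 * t * a <= t ^+ 2 * b) -> a <= 0.
Proof.
clear; move=> b0 key; rewrite leNgt; apply/negP => a0.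
(* close to the minimiser a / b, but at most 1 and defined when b = 0 *)
pose t := a / (a + b).
have ab : 0 < a + b by rewrite ltr_wpDr.
have t0 : 0 < t by rewrite divr_gt0.
have /key : 0 <= t <= 1 by rewrite ltW//= ler_pdivrMr// mul1r lerDl.
rewrite mulrAC mulrC expr2 -mulrA ler_pM2l// => h.
have : t * b <= a by rewrite /t mulrAC ler_pdivrMr// ler_pM2l// lerDr ltW.
lra.
Qed.

(** A minimizing sequence in [W] has a cluster point, and the distance to [X]
    is continuous. *)
Lemma is_proj_proj X : is_proj W X (proj W X).
Proof.
rewrite /proj; case: xgetP => [Y -> //|] noproj; exfalso.
pose I := inf [set frob_norm (X - Z) | Z in W].
have dist_ge Z : W Z -> I <= frob_norm (X - Z).
  move=> WZ; apply: ge_inf; last by exists Z.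
  by exists 0 => _ [Z' _ <-]; exact: frob_norm_ge0.
have near_min (k : nat) : exists Z, W Z /\ frob_norm (X - Z) < I + k.+1%:R^-1.
  have [||_ [Z WZ <-] h] := @inf_adherent _ [set frob_norm (X - Z) | Z in W] k.+1%:R^-1.
  - by rewrite invr_gt0.
  - split; first by exists (frob_norm (X - 0)); exists 0.
    by exists 0 => _ [Z' _ <-]; exact: frob_norm_ge0.
  by exists Z.
have [S SW] := choice near_min.
have [Y WY clY] := @compact_mx_cluster _ _ W S W_compact (fun k => (SW k).1).
apply: (noproj Y); split=> [|Z WZ]; first exact: WY.
apply/ler_addgt0Pr => e e0.
have e2 : 0 < e / 2 by rewrite divr_gt0.
have [k Nk SkY] := clY _ e2 (Num.truncn (e / 2)^-1).
have ke : k.+1%:R^-1 < e / 2.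
  by rewrite invf_plt ?posrE// (lt_le_trans (truncnS_gt _))// ler_nat ltnS.
exact: approx_min (frob_dist_triangle (S k) X Y) (SW k).2 SkY ke (dist_ge _ WZ).
Qed.

Lemma proj_in X : W (proj W X).
Proof. exact: (is_proj_proj X).1. Qed.

(** Moving from the projection towards [Z] stays in [W], hence cannot decrease
    the distance to [X]; the inequality is the first-order term. *)
Lemma proj_variational X Z : W Z -> frob_inner (X - proj W X) (Z - proj W X) <= 0.
Proof.
move=> WZ; have [WP minP] := is_proj_proj X; set P := proj W X in WP minP *.
set a := frob_inner _ _; set b := frob_inner (Z - P) (Z - P).
have key t : 0 <= t <= 1 -> 2 * t * a <= t ^+ 2 * b.
  move=> /andP[t0 t1].
  have /minP : W (t%:C *: Z + (1 - t)%:C *: P) by apply: W_convex; rewrite ?t0.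
  have -> : X - (t%:C *: Z + (1 - t)%:C *: P) = (X - P) - t%:C *: (Z - P).
    by apply/matrixP => i j; rewrite !mxE rmorphB/=; ring.
  rewrite frob_norm_le.
  have -> : frob_inner (X - P - t%:C *: (Z - P)) (X - P - t%:C *: (Z - P)) =
      frob_inner (X - P) (X - P) + (t ^+ 2 * b - 2 * t * a).
    exact: (sqr_sub_scale (@frob_inner R n) (fun t Z => t%:C *: Z)
      (@frob_innerC R n) (@frob_innerDr R n) (@frob_innerNr R n)
      (@frob_innerZr R n)).
  by rewrite lerDl subr_ge0.
exact: quadratic_le0 (frob_inner_ge0 _) key.
Qed.

Lemma proj_nonexpansive X Y :
  frob_norm (proj W X - proj W Y) <= frob_norm (X - Y).
Proof.
set P := proj W X; set Q := proj W Y.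
have h1 : frob_inner (X - P) (Q - P) <= 0 by apply: proj_variational; exact: proj_in.
have h2 : frob_inner (Y - Q) (P - Q) <= 0 by apply: proj_variational; exact: proj_in.
have := variational_monotone _ (@frob_innerC R n) (@frob_innerDr R n)
  (@frob_innerNr R n) _ _ _ _ h1 h2.
rewrite -sqr_frob_norm => h3; apply: (le_of_sqr_le _ _ (frob_norm_ge0 _) (frob_norm_ge0 _)).
exact: le_trans h3 (frob_cauchy_schwarz _ _).
Qed.

Variable DW : set 'rV[R]_n.
Hypotheses (W_DW : W = [set X | exists v U,
     [/\ DW v, U \is unitarymx & X = U *m real_diag v *m U ^t*]])
  (DW_convex : convex_rV DW) (DW_ortho : orthosymmetric DW).

Definition kill_coord i v : 'rV[R]_n := \row_j (if j == i then 0 else v 0 j).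

(** Zeroing a coordinate is averaging a vector with its reflection. *)
Lemma kill_coord_in i v : DW v -> DW (kill_coord i v).
Proof.
move=> Dv; pose s : 'rV[R]_n := \row_j (if j == i then -1 else 1).
have -> : kill_coord i v = 2^-1 *: v + (1 - 2^-1) *: (v *m diag_mx s).
  by rewrite mul_mx_diag; apply/rowP => j; rewrite !mxE; case: eqP => _; field.
apply: DW_convex => //; last by lra.
by apply: DW_ortho => // j; rewrite mxE; case: eqP; [right|left].
Qed.

(** Projecting does not push eigenvalues below a nonpositive lower bound. If
    [proj W X = U diag(v) U^*] had [v_i < - c <= 0], then zeroing [v_i] would
    give another element of [W], and the variational inequality against it
    says that the form of [X] at the i-th column of [U] is at most [v_i]. *)
Lemma form_ge_proj X c : 0 <= c -> form_ge X (- c) -> form_ge (proj W X) (- c).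
Proof.
move=> c0 Xc; have := proj_in X; rewrite {1}W_DW => -[v [U [Dv Uu Pe]]].
rewrite Pe; apply: form_ge_unitary_diag => // i.
rewrite leNgt; apply/negP => vi.
pose v' := kill_coord i v; pose Y := U *m real_diag v' *m U ^t*.
have WY : W Y by rewrite W_DW; exists v', U; split=> //; exact: kill_coord_in.
have := proj_variational X Y WY.
have -> : Y - proj W X = U *m real_diag (v' - v) *m U ^t*.
  rewrite Pe -mulmxBl -mulmxBr; congr (_ *m _ *m _).
  by rewrite /real_diag map_mxB raddfB.
rewrite frob_inner_unitary_diag// (bigD1 i)//= big1 ?addr0; last first.
  by move=> j /negPf ji; rewrite !mxE ji subrr mul0r.
rewrite !mxE eqxx sub0r form_mxDm form_mxNm Pe form_mx_unitary_diag_col// ReD ReN /=.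
have := Xc (col i U); rewrite sqnorm_col// mulr1.
by move=> h1 h2; nra.
Qed.

End projection.

(** * Measurability and integrals of complex functions *)

Lemma ReV {R : realType} (x : R[i]) : complex.Re x^-1 =
  complex.Re x * (complex.Re x ^+ 2 + complex.Im x ^+ 2)^-1.
Proof. by case: x. Qed.

Lemma ImV {R : realType} (x : R[i]) : complex.Im x^-1 =
  - complex.Im x * (complex.Re x ^+ 2 + complex.Im x ^+ 2)^-1.
Proof. by case: x => a b /=; rewrite mulNr. Qed.

Section complex_measurability.
Context {d} {T : measurableType d} {R : realType}.
Local Notation C := R[i].
Local Notation Re := (@complex.Re R).
Local Notation Im := (@complex.Im R).
Local Notation normc := (@Normc.normc R).
Implicit Types (D : set T) (g h : T -> C).

Lemma cmeasurable_cst D (c : C) : cmeasurable_fun D (fun=> c).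
Proof. by split; exact: measurable_cst. Qed.

Lemma cmeasurableD D g h : cmeasurable_fun D g -> cmeasurable_fun D h ->
  cmeasurable_fun D (fun x => g x + h x).
Proof.
move=> [gr gi] [hr hi]; split; under eq_fun do rewrite ?ReD ?ImD;
  exact: measurable_funD.
Qed.

Lemma cmeasurableN D g : cmeasurable_fun D g -> cmeasurable_fun D (fun x => - g x).
Proof.
move=> [gr gi]; split; under eq_fun do rewrite ?ReN ?ImN; exact: measurable_funN.
Qed.

Lemma cmeasurableM D g h : cmeasurable_fun D g -> cmeasurable_fun D h ->
  cmeasurable_fun D (fun x => g x * h x).
Proof.
move=> [gr gi] [hr hi]; split.
  by under eq_fun do rewrite ReM; apply: measurable_funB; exact: measurable_funM.
by under eq_fun do rewrite ImM; apply: measurable_funD; exact: measurable_funM.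
Qed.

Lemma cmeasurableJ D g : cmeasurable_fun D g ->
  cmeasurable_fun D (fun x => Num.conj (g x)).
Proof.
move=> [gr gi]; split; first by under eq_fun do rewrite conjCE Re_conj.
by under eq_fun do rewrite conjCE Im_conj; exact: measurable_funN.
Qed.

Lemma cmeasurable_sum D (I : Type) (s : seq I) (g : I -> T -> C) :
  (forall i, cmeasurable_fun D (g i)) ->
  cmeasurable_fun D (fun x => \sum_(i <- s) g i x).
Proof.
move=> mg; split; under eq_fun do rewrite ?Re_sum ?Im_sum;
  apply: measurable_sum => i; by have [] := mg i.
Qed.

Lemma measurable_inv_ge0 D (g : T -> R) : measurable_fun D g ->
  (forall x, 0 <= g x) -> measurable_fun D (fun x => (g x)^-1).
Proof.
move=> mg g0; under eq_fun do rewrite -powR_inv1//.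
exact: (measurableT_comp (measurable_powR _)).
Qed.

Lemma cmeasurableV D g : cmeasurable_fun D g ->
  cmeasurable_fun D (fun x => (g x)^-1).
Proof.
move=> [gr gi]; have mn : measurable_fun D (fun x => (Re (g x) ^+ 2 + Im (g x) ^+ 2)^-1).
  apply: measurable_inv_ge0 => [|x]; last by rewrite addr_ge0 ?sqr_ge0.
  by apply: measurable_funD; exact: measurable_funX.
split.
  by under eq_fun do rewrite ReV; exact: measurable_funM.
by under eq_fun do rewrite ImV; apply: measurable_funM => //; exact: measurable_funN.
Qed.

Lemma measurable_normc D g : cmeasurable_fun D g -> measurable_fun D (fun x => normc (g x)).
Proof.
move=> [gr gi]; have -> : (fun x => normc (g x)) =
    fun x => Num.sqrt (Re (g x) ^+ 2 + Im (g x) ^+ 2).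
  by apply/funext => x; case: (g x).
apply: (measurableT_comp (f := @Num.sqrt R)).
  by apply: continuous_measurable_fun; exact: sqrt_continuous.
by apply: measurable_funD; exact: measurable_funX.
Qed.

End complex_measurability.

Lemma sum_sqr_le {R : realDomainType} (a b c : R) : 0 <= a -> 0 <= b ->
  a <= c -> b <= c -> a ^+ 2 + b ^+ 2 <= (2 * c) ^+ 2.
Proof. by move=> *; nra. Qed.

Section complex_integrals.
Context {d} {T : measurableType d} {R : realType}.
Variable mu : {measure set T -> \bar R}.
Local Notation C := R[i].
Local Notation Re := (@complex.Re R).
Local Notation Im := (@complex.Im R).
Local Notation normc := (@Normc.normc R).
Variable D : set T.
Hypothesis mD : measurable D.
Implicit Types (g h : T -> C).

Definition cintegrable g : Prop :=
  mu.-integrable D (EFin \o (Re \o g)) /\ mu.-integrable D (EFin \o (Im \o g)).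

Lemma eq_Cintegral g h : (forall x, D x -> g x = h x) ->
  Cintegral mu D g = Cintegral mu D h.
Proof.
by move=> gh; congr Complex; apply: eq_Rintegral => x /set_mem Dx; rewrite gh.
Qed.

Lemma cintegrable_dom g (w : T -> R) : cmeasurable_fun D g ->
  mu.-integrable D (EFin \o w) -> (forall x, D x -> normc (g x) <= w x) ->
  cintegrable g.
Proof.
move=> [gr gi] iw gw; split; apply: (le_integrable mD _ _ iw);
  [exact/measurable_EFinP|move=> x Dx|exact/measurable_EFinP|move=> x Dx];
  rewrite /= lee_fin (le_trans _ (ler_norm _))// (le_trans _ (gw x Dx))//.
- exact: ler_Re.
- exact: ler_Im.
Qed.

Lemma cintegrable0 : cintegrable (fun=> 0).
Proof. by split; exact: integrable0. Qed.

Lemma cintegrableD g h : cintegrable g -> cintegrable h ->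
  cintegrable (fun x => g x + h x).
Proof.
move=> [gr gi] [hr hi]; split.
  rewrite (_ : _ \o _ = ((EFin \o (Re \o g)) \+ (EFin \o (Re \o h)))%E).
    exact: integrableD.
  by apply/funext => x /=; rewrite ReD EFinD.
rewrite (_ : _ \o _ = ((EFin \o (Im \o g)) \+ (EFin \o (Im \o h)))%E).
  exact: integrableD.
by apply/funext => x /=; rewrite ImD EFinD.
Qed.

Lemma CintegralD g h : cintegrable g -> cintegrable h ->
  Cintegral mu D (fun x => g x + h x) = Cintegral mu D g + Cintegral mu D h.
Proof.
move=> [gr gi] [hr hi]; apply: complexRI; rewrite ?ReD ?ImD /=.
  by rewrite -RintegralD//; apply: eq_Rintegral => x _; rewrite ReD.
by rewrite -RintegralD//; apply: eq_Rintegral => x _; rewrite ImD.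
Qed.

Lemma cintegrableZl c g : cintegrable g -> cintegrable (fun x => c * g x).
Proof.
move=> [gr gi]; split.
  rewrite (_ : _ \o _ = ((fun x => (Re c)%:E * (EFin \o (Re \o g)) x) \-
     (fun x => (Im c)%:E * (EFin \o (Im \o g)) x))%E).
    by apply: integrableB => //; exact: integrableZl.
  by apply/funext => x /=; rewrite ReM EFinB !EFinM.
rewrite (_ : _ \o _ = ((fun x => (Re c)%:E * (EFin \o (Im \o g)) x) \+
     (fun x => (Im c)%:E * (EFin \o (Re \o g)) x))%E).
  by apply: integrableD => //; exact: integrableZl.
by apply/funext => x /=; rewrite ImM EFinD !EFinM.
Qed.

Lemma CintegralZl c g : cintegrable g ->
  Cintegral mu D (fun x => c * g x) = c * Cintegral mu D g.
Proof.
have iZ r (w : T -> R) : mu.-integrable D (EFin \o w) ->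
    mu.-integrable D (EFin \o (fun x => r * w x)).
  move=> iw; rewrite (_ : _ \o _ = (fun x => r%:E * (EFin \o w) x)%E).
    exact: integrableZl.
  by apply/funext => x /=; rewrite EFinM.
move=> [gr gi]; apply: complexRI; rewrite ?ReM ?ImM /=.
  rewrite -!RintegralZl// -RintegralB//; [|exact: iZ..].
  by apply: eq_Rintegral => x _; rewrite ReM.
rewrite -!RintegralZl// -RintegralD//; [|exact: iZ..].
by apply: eq_Rintegral => x _; rewrite ImM.
Qed.

Lemma Cintegral_sum (I : Type) (s : seq I) (g : I -> T -> C) :
  (forall i, cintegrable (g i)) ->
  cintegrable (fun x => \sum_(i <- s) g i x) /\
  Cintegral mu D (fun x => \sum_(i <- s) g i x) = \sum_(i <- s) Cintegral mu D (g i).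
Proof.
move=> ig; elim: s => [|i s [IHi IH]].
  rewrite big_nil; under eq_fun do rewrite big_nil; split; first exact: cintegrable0.
  by rewrite /Cintegral /= (_ : (\int[mu]_(_ in D) 0) = 0)// /Rintegral integral0.
rewrite big_cons; under eq_fun do rewrite big_cons.
by split; [exact: cintegrableD|rewrite CintegralD// IH].
Qed.

Lemma Re_Cintegral_ge0 g : (forall x, D x -> 0 <= Re (g x)) ->
  0 <= Re (Cintegral mu D g).
Proof. exact: Rintegral_ge0. Qed.

Lemma normc_Cintegral_le g (w : T -> R) : cmeasurable_fun D g ->
  mu.-integrable D (EFin \o w) -> (forall x, D x -> normc (g x) <= w x) ->
  normc (Cintegral mu D g) <= 2 * \int[mu]_(x in D) w x.
Proof.
move=> mg iw gw; have [ir ii] := cintegrable_dom g w mg iw gw.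
have bound (v : T -> R) : mu.-integrable D (EFin \o v) ->
    (forall x, D x -> `|v x| <= w x) -> `|\int[mu]_(x in D) v x| <= \int[mu]_(x in D) w x.
  move=> iv vw; apply: (le_trans (le_normr_Rintegral mD iv)).
  by apply: le_Rintegral => //; exact: (integrable_abse iv).
have hr : `|Re (Cintegral mu D g)| <= \int[mu]_(x in D) w x.
  by apply: bound => // x Dx; rewrite (le_trans (ler_Re _))// gw.
have hi : `|Im (Cintegral mu D g)| <= \int[mu]_(x in D) w x.
  by apply: bound => // x Dx; rewrite (le_trans (ler_Im _))// gw.
have W0 : 0 <= \int[mu]_(x in D) w x by rewrite (le_trans _ hr).
apply: ler_normc; first by rewrite mulr_ge0.
rewrite -[Re _ ^+ 2]real_normK ?num_real// -[Im _ ^+ 2]real_normK ?num_real//.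
have := normr_ge0 (Re (Cintegral mu D g)); have := normr_ge0 (Im (Cintegral mu D g)).
by move=> i0 r0; exact: sum_sqr_le.
Qed.

End complex_integrals.

(** * Measurability of Fourier transforms *)

Section fourier_measurability.
Context {R : realType} (d : nat).
Local Notation Re := (@complex.Re R).
Local Notation Im := (@complex.Im R).
Local Notation E := 'rV[R]_d.

(** The integral is by definition the difference of the integrals of the positive
    and negative parts, and Tonelli applies to each. *)
Lemma measurable_parametric_integral (h : E * E -> R) : measurable_fun setT h ->
  measurable_fun setT (fun xi => \int[lebesgue_rV d]_x h (xi, x)).
Proof.
move=> mh; apply: (@measurableT_comp _ _ _ _ _ _ (@fine R)) => //.
under eq_fun do rewrite integralE.
have me : measurable_fun setT (EFin \o h) by exact/measurable_EFinP.
apply: emeasurable_funB.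
  have mp : measurable_fun setT ((EFin \o h)^\+)%E by exact: measurable_funepos.
  apply: (eq_measurable_fun _ _ (measurable_fun_fubini_tonelli_F (m2 := lebesgue_rV d)
    _ mp (funepos_ge0 _))) => x _.
  by apply: eq_integral => y _; rewrite !funeposE.
have mn : measurable_fun setT ((EFin \o h)^\-)%E by exact: measurable_funeneg.
apply: (eq_measurable_fun _ _ (measurable_fun_fubini_tonelli_F (m2 := lebesgue_rV d)
  _ mn (funeneg_ge0 _))) => x _.
by apply: eq_integral => y _; rewrite !funenegE.
Qed.

Lemma cmeasurable_fourier (u : E -> R[i]) : cmeasurable_fun setT u ->
  cmeasurable_fun setT (fourier u).
Proof.
move=> mu; pose k (p : E * E) := u p.2 * expi (- (2 * pi * dotrV p.2 p.1)).
have mk : cmeasurable_fun setT k.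
  apply: cmeasurableM.
    case: mu => mr mi; split; first exact: (measurableT_comp mr measurable_snd).
    exact: (measurableT_comp mi measurable_snd).
  have mdot : measurable_fun setT (fun p : E * E => - (2 * pi * dotrV p.2 p.1)).
    apply: measurable_funN; apply: measurable_funM; first exact: measurable_cst.
    apply: measurable_sum => i; apply: measurable_funM.
      exact: (measurableT_comp (measurable_coord_rV i) measurable_snd).
    exact: (measurableT_comp (measurable_coord_rV i) measurable_fst).
  have mcos : measurable_fun setT (@cos R).
    by apply: continuous_measurable_fun; exact: continuous_cos.
  have msin : measurable_fun setT (@sin R).
    by apply: continuous_measurable_fun; exact: continuous_sin.
  split; first exact: (measurableT_comp mcos mdot).
  exact: (measurableT_comp msin mdot).
split.
  exact: (measurable_parametric_integral (fun p => Re (k p)) mk.1).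
exact: (measurable_parametric_integral (fun p => Im (k p)) mk.2).
Qed.

End fourier_measurability.

(** * Weighted least squares *)

Lemma sub_sub_scale {F : pzRingType} {V : lmodType F} (c e : F) (x y : V) :
  x - c *: y - (x - e *: y) = (e - c) *: y.
Proof. by rewrite scalerBl opprB addrC -addrA addKr. Qed.

Section weighted_least_squares.
Context {R : realType} {n : nat}.
Local Notation C := R[i].
Local Notation Re := (@complex.Re R).
Local Notation normc := (@Normc.normc R).
Implicit Types (A B E : 'M[C]_n) (x y r : 'cV[C]_n).

(** When [A] is an inner product, [wcoef A y x *: y] is the orthogonal
    projection of [x] onto the line of [y]. *)
Definition wcoef A y x : C := form_mx A y x / form_mx A y y.

Let cancel_scale (c l s b n1 N k : R) : 0 <= b -> 0 <= n1 -> 0 < l -> 0 < s ->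
  0 <= N -> c * (l * s) <= b * N * n1 -> N ^+ 2 <= k * s -> c * N <= k * b / l * n1.
Proof.
move=> b0 n0 l0 s0 N0 h1 h2; rewrite mulrAC ler_pdivlMr// -(ler_pM2r s0).
apply: (@le_trans _ _ (N * (b * N * n1))).
  by rewrite -!mulrA mulrCA ler_wpM2l// !mulrA; move: h1; rewrite !mulrA.
have -> : N * (b * N * n1) = b * n1 * N ^+ 2 by ring.
have -> : k * b * n1 * s = b * n1 * (k * s) by ring.
by rewrite ler_wpM2l// mulr_ge0.
Qed.

(** Both the size of the projection and its dependence on the weight reduce to
    an equation for a coefficient of this shape. *)
Lemma coef_bound B E (c : C) (l b : R) y r : 0 < l -> form_ge B l -> 0 <= b ->
  (forall i j, normc (E i j) <= b) -> c * form_mx B y y = form_mx E y r ->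
  normc c * norm1 y <= n%:R * b / l * norm1 r.
Proof.
move=> l0 Bl b0 Eb cE; have [->|y0] := eqVneq y 0.
  have -> : norm1 (0 : 'cV[C]_n) = 0.
    by rewrite /norm1 big1// => i _; rewrite mxE Normc.normc0.
  by rewrite mulr0 !mulr_ge0 ?norm1_ge0// invr_ge0 ltW.
apply: (cancel_scale _ _ (sqnorm y)) => //; [exact: norm1_ge0|exact: sqnorm_gt0
  |exact: norm1_ge0| |exact: sqr_norm1_le].
apply: le_trans (normc_form_mx E b y r Eb); rewrite -cE Normc.normcM.
rewrite ler_wpM2l ?normc_ge0// (le_trans (Bl y))// (le_trans (ler_norm _))//.
exact: ler_Re.
Qed.

(** The normal equation. At [y = 0] both sides vanish, whatever the quotient
    0 / 0 is. *)
Lemma wcoefK A (l : R) y x : 0 < l -> form_ge A l ->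
  wcoef A y x * form_mx A y y = form_mx A y x.
Proof.
move=> l0 Al; have [->|y0] := eqVneq y 0.
  by rewrite /form_mx trmx0 map_mx0 !mul0mx !mxE mulr0.
rewrite divfK//; apply/eqP => h; have := Al y; rewrite h /= leNgt.
by rewrite mulr_gt0// sqnorm_gt0.
Qed.

Lemma wcoef_scale_bound A (l a : R) y x : 0 < l -> form_ge A l -> 0 <= a ->
  (forall i j, normc (A i j) <= a) ->
  norm1 (wcoef A y x *: y) <= n%:R * a / l * norm1 x.
Proof.
by move=> l0 Al a0 Aa; rewrite norm1Z; apply: coef_bound Aa _ => //; apply: wcoefK Al.
Qed.

Lemma wcoef_residual_bound A (l a : R) y x : 0 < l -> form_ge A l -> 0 <= a ->
  (forall i j, normc (A i j) <= a) ->
  norm1 (x - wcoef A y x *: y) <= (1 + n%:R * a / l) * norm1 x.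
Proof.
move=> l0 Al a0 Aa; apply: le_trans (norm1D _ _) _.
by rewrite norm1N mulrDl mul1r lerD2l; exact: wcoef_scale_bound Al a0 Aa.
Qed.

(** The residual [r = x - wcoef A y x *: y] is [A]-orthogonal to [y], so the
    difference [c] of the coefficients satisfies
    [c (y, y)_B = (y, r)_B = (y, r)_(B - A)]. *)
Lemma wcoef_dist A B (l b : R) y x : 0 < l -> form_ge A l -> form_ge B l ->
  0 <= b -> (forall i j, normc ((A - B) i j) <= b) ->
  normc (wcoef B y x - wcoef A y x) * norm1 y <=
    n%:R * b / l * norm1 (x - wcoef A y x *: y).
Proof.
move=> l0 Al Bl b0 ABb; apply: (coef_bound B (- (A - B))) => //.
  by move=> i j; rewrite mxE normcN.
rewrite mulrBl (wcoefK B l y x l0 Bl); have hA := wcoefK A l y x l0 Al.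
rewrite opprB form_mxDm form_mxNm !form_mxDr !form_mxNr !form_mxZr hA; ring.
Qed.

Lemma wcoef_residual_dist A B (l b : R) y x : 0 < l -> form_ge A l -> form_ge B l ->
  0 <= b -> (forall i j, normc ((A - B) i j) <= b) ->
  norm1 (x - wcoef A y x *: y - (x - wcoef B y x *: y)) <=
    n%:R * b / l * norm1 (x - wcoef A y x *: y).
Proof.
move=> l0 Al Bl b0 ABb; rewrite sub_sub_scale norm1Z; exact: wcoef_dist.
Qed.

End weighted_least_squares.

Lemma product_bound {R : realFieldType} (p q r k z n b l : R) :
  0 <= n * b / l -> 0 <= p -> 0 <= q -> 0 <= r ->
  p <= n * b / l * q -> q <= k * z -> r <= k * z ->
  p * (q + r) <= 2 * n * k ^+ 2 / l * b * z ^+ 2.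
Proof.
move=> t0 p0 q0 r0 pq qk rk.
apply: (@le_trans _ _ (n * b / l * (k * z) * (k * z + k * z))).
  by rewrite ler_pM ?addr_ge0 ?lerD// (le_trans pq)// ler_wpM2l.
by rewrite le_eqVlt; apply/orP; left; apply/eqP; ring.
Qed.

(** * The matrix G along the least squares quotients *)

Section residual_integrals.
Context {R : realType} {d n : nat}.
Local Notation C := R[i].
Local Notation Re := (@complex.Re R).
Local Notation normc := (@Normc.normc R).
Variables (mu : {measure set 'rV[R]_d -> \bar R}) (Omega0 : set 'rV[R]_d).
Variables (alpha : R) (f : 'I_n -> 'rV[R]_d -> C).
Hypotheses (mOmega0 : measurable Omega0)
  (mf : forall i, cmeasurable_fun Omega0 (f i))
  (Df_L2 : forall i, in_L2 mu Omega0 (dilate alpha (f i))).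
Variable delta : R.
Implicit Types S : 'M[C]_n.
Local Notation m_of S := (m_update alpha f delta S).
Local Notation res S := (residual alpha f (m_of S)).

(** Majorizes, up to a constant, every entry of the outer product of a residual,
    uniformly in the weight. *)
Definition dominator (xi : 'rV[R]_d) : R := norm1 (Dfvec alpha f xi) ^+ 2.

Lemma dominator_ge0 xi : 0 <= dominator xi.
Proof. exact: sqr_ge0. Qed.

Lemma integrable_dominator : mu.-integrable Omega0 (EFin \o dominator).
Proof.
pose w xi := \sum_i n%:R * normc (dilate alpha (f i) xi) ^+ 2.
have mnorm i : measurable_fun Omega0 (fun xi => normc (dilate alpha (f i) xi)).
  by apply: measurable_normc; have [] := Df_L2 i.
have mdom : measurable_fun Omega0 dominator.
  apply: measurable_funX; apply: measurable_sum => i.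
  by under eq_fun do rewrite mxE; exact: mnorm.
apply: (le_integrable mOmega0 (f := EFin \o dominator) (g := EFin \o w)).
- exact/measurable_EFinP.
- move=> xi _ /=; rewrite lee_fin ger0_norm ?dominator_ge0//.
  rewrite (le_trans _ (ler_norm _))// (le_trans (sqr_norm1_le _))//.
  rewrite mulr_sumr le_eqVlt; apply/orP; left; apply/eqP.
  by apply: eq_bigr => i _; rewrite mxE.
- rewrite (_ : _ \o _ = fun xi => (\sum_i (n%:R%:E * (normc (dilate alpha (f i) xi) ^+ 2)%:E))%E).
    apply: integrable_sum => // i _; apply: integrableZl => //.
    apply/integrableP; split.
      by apply/measurable_EFinP; exact: measurable_funX.
    under eq_integral do rewrite gee0_abs ?lee_fin ?sqr_ge0//.
    by have [] := Df_L2 i.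
  by apply/funext => xi /=; rewrite -sumEFin.
Qed.

Lemma m_updateE S xi :
  m_of S xi = wcoef (regularized delta S) (fvec f xi) (Dfvec alpha f xi).
Proof. by []. Qed.

Lemma cmeasurable_form S (x y : 'rV[R]_d -> 'cV[C]_n) :
  (forall i, cmeasurable_fun Omega0 (fun xi => x xi i 0)) ->
  (forall i, cmeasurable_fun Omega0 (fun xi => y xi i 0)) ->
  cmeasurable_fun Omega0 (fun xi => form_mx S (x xi) (y xi)).
Proof.
move=> mx my; under eq_fun do rewrite form_mxE.
apply: cmeasurable_sum => i; apply: cmeasurable_sum => j.
apply: cmeasurableM => //; apply: cmeasurableM; last exact: cmeasurable_cst.
exact: cmeasurableJ.
Qed.

Lemma cmeasurable_fvec i : cmeasurable_fun Omega0 (fun xi => fvec f xi i 0).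
Proof. by under eq_fun do rewrite mxE; exact: mf. Qed.

Lemma cmeasurable_Dfvec i : cmeasurable_fun Omega0 (fun xi => Dfvec alpha f xi i 0).
Proof. by under eq_fun do rewrite mxE; have [] := Df_L2 i. Qed.

Lemma cmeasurable_residual S i :
  cmeasurable_fun Omega0 (fun xi => res S xi i 0).
Proof.
under eq_fun do rewrite !mxE.
apply: cmeasurableD; first by have [] := Df_L2 i.
apply: cmeasurableN; apply: cmeasurableM; last exact: mf.
apply: cmeasurableM; first exact: cmeasurable_form cmeasurable_fvec cmeasurable_Dfvec.
apply: cmeasurableV; exact: cmeasurable_form cmeasurable_fvec cmeasurable_fvec.
Qed.

Lemma half_complex : (2^-1)%:C = 2^-1 :> C.
Proof. by rewrite fmorphV rmorphMn. Qed.

Lemma half_sub_Cintegral g h : cintegrable mu Omega0 g -> cintegrable mu Omega0 h ->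
  2^-1 * Cintegral mu Omega0 g - 2^-1 * Cintegral mu Omega0 h =
  (2^-1)%:C * Cintegral mu Omega0 (fun xi => g xi + (-1) * h xi).
Proof.
move=> ig ih; rewrite (CintegralD mu _ mOmega0)//; last exact: (cintegrableZl mu _ mOmega0).
by rewrite (CintegralZl mu _ mOmega0)// half_complex mulN1r mulrBr.
Qed.

Lemma GmxE m i j : Gmx mu Omega0 alpha f m i j = 2^-1 * Cintegral mu Omega0
  (fun xi => (residual alpha f m xi *m (residual alpha f m xi) ^t*) i j).
Proof. by rewrite /Gmx mxE mxE. Qed.

Lemma outerE (r : 'cV[C]_n) i j : (r *m r ^t*) i j = r i 0 * Num.conj (r j 0).
Proof. by rewrite !mxE big_ord1 !mxE. Qed.

Lemma cmeasurable_outer S i j :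
  cmeasurable_fun Omega0 (fun xi => (res S xi *m (res S xi) ^t*) i j).
Proof.
under eq_fun do rewrite outerE; apply: cmeasurableM; first exact: cmeasurable_residual.
by apply: cmeasurableJ; exact: cmeasurable_residual.
Qed.

Lemma normc_outer (r : 'cV[C]_n) i j : normc ((r *m r ^t*) i j) <= norm1 r ^+ 2.
Proof.
rewrite outerE Normc.normcM normcJ expr2.
by rewrite ler_pM ?normc_ge0 ?normc_le_norm1.
Qed.

Lemma normc_outer_dist (r s : 'cV[C]_n) i j :
  normc ((r *m r ^t*) i j - (s *m s ^t*) i j) <=
  norm1 (r - s) * (norm1 r + norm1 s).
Proof.
rewrite !outerE.
have -> : r i 0 * Num.conj (r j 0) - s i 0 * Num.conj (s j 0) =
    (r - s) i 0 * Num.conj (r j 0) + s i 0 * Num.conj ((r - s) j 0).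
  by rewrite !mxE rmorphB/=; ring.
rewrite (le_trans (normcD _ _))// !Normc.normcM !normcJ mulrDr.
apply: lerD; first by rewrite ler_pM ?normc_ge0 ?normc_le_norm1.
by rewrite [leLHS]mulrC ler_pM ?normc_ge0 ?normc_le_norm1.
Qed.

Section one_weight.
Variables (S : 'M[C]_n) (l a : R).
Hypotheses (l0 : 0 < l) (Sl : form_ge (regularized delta S) l) (a0 : 0 <= a)
  (Sa : forall i j, normc (regularized delta S i j) <= a).
Let kappa := 1 + n%:R * a / l.

Lemma norm1_residual xi : norm1 (res S xi) <= kappa * norm1 (Dfvec alpha f xi).
Proof. by rewrite /residual m_updateE; exact: wcoef_residual_bound. Qed.

Lemma cintegrable_outer i j :
  cintegrable mu Omega0 (fun xi => (res S xi *m (res S xi) ^t*) i j).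
Proof.
apply: (cintegrable_dom mu _ mOmega0 _ (fun xi => kappa ^+ 2 * dominator xi)).
- exact: cmeasurable_outer.
- rewrite (_ : _ \o _ = (fun xi => (kappa ^+ 2)%:E * (EFin \o dominator) xi)%E).
    by apply: integrableZl => //; exact: integrable_dominator.
  by apply/funext => xi /=; rewrite EFinM.
- move=> xi _; rewrite (le_trans (normc_outer _ _ _))// /dominator -exprMn.
  have h := norm1_residual xi.
  by rewrite ler_sqr ?nnegrE ?norm1_ge0// (le_trans _ h)// norm1_ge0.
Qed.

(** The form of [G] at [v] is half of the integral of the squared modulus of
    [v^* r], where [r] is the residual. *)
Lemma Gmx_form_ge0 : form_ge (Gmx mu Omega0 alpha f (m_of S)) 0.
Proof.
move=> v; rewrite mul0r.
rewrite form_mxE.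
pose F i j xi := Num.conj (v i 0) * v j 0 * (res S xi *m (res S xi) ^t*) i j.
have iF i j : cintegrable mu Omega0 (F i j)
  by exact: (cintegrableZl mu _ mOmega0 _ _ (cintegrable_outer i j)).
have iFi i := Cintegral_sum mu _ mOmega0 _ (index_enum 'I_n) (F i) (iF i).
have [_ E] := Cintegral_sum mu _ mOmega0 _ (index_enum 'I_n)
  (fun i xi => \sum_j F i j xi) (fun i => (iFi i).1).
have -> : \sum_i \sum_j Num.conj (v i 0) * Gmx mu Omega0 alpha f (m_of S) i j * v j 0 =
    (2^-1)%:C * Cintegral mu Omega0 (fun xi => \sum_i \sum_j F i j xi).
  rewrite E mulr_sumr; apply: eq_bigr => i _; rewrite (iFi i).2 mulr_sumr.
  apply: eq_bigr => j _; rewrite (CintegralZl mu _ mOmega0 _ _ (cintegrable_outer i j)).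
  rewrite GmxE half_complex; move: (Cintegral _ _ _) => z; ring.
rewrite ReM /= mul0r subr0 mulr_ge0 ?invr_ge0//.
apply: Re_Cintegral_ge0 => xi _.
have -> : \sum_i \sum_j F i j xi =
    (\sum_i Num.conj (v i 0) * res S xi i 0) *
    Num.conj (\sum_i Num.conj (v i 0) * res S xi i 0).
  rewrite mulr_suml; apply: eq_bigr => i _; rewrite rmorph_sum mulr_sumr.
  by apply: eq_bigr => j _; rewrite /F outerE rmorphM/= conjCK; ring.
by rewrite mulrC conj_mulE sqr_ge0.
Qed.

End one_weight.

(** Factor by factor: a residual is at most [1 + n a / l] times
    [D_alpha f], the difference of two residuals is at most [n b / l] times a
    residual, and the outer product is quadratic in the residual. *)
Lemma Gmx_dist S S' (l a b : R) : 0 < l ->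
  form_ge (regularized delta S) l -> form_ge (regularized delta S') l ->
  0 <= a -> (forall i j, normc (regularized delta S i j) <= a) ->
  (forall i j, normc (regularized delta S' i j) <= a) ->
  0 <= b -> (forall i j, normc ((S - S') i j) <= b) ->
  frob_norm (Gmx mu Omega0 alpha f (m_of S) - Gmx mu Omega0 alpha f (m_of S')) <=
  n%:R ^+ 2 * (2 * n%:R * (1 + n%:R * a / l) ^+ 2 / l * b *
    \int[mu]_(xi in Omega0) dominator xi).
Proof.
move=> l0 Sl S'l a0 Sa S'a b0 SS'b; apply: frob_norm_le_const => i j.
set k := 1 + n%:R * a / l.
pose g xi := (res S xi *m (res S xi) ^t*) i j + (-1) * (res S' xi *m (res S' xi) ^t*) i j.
have iS := cintegrable_outer S l a l0 Sl a0 Sa i j.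
have iS' := cintegrable_outer S' l a l0 S'l a0 S'a i j.
have -> : (Gmx mu Omega0 alpha f (m_of S) - Gmx mu Omega0 alpha f (m_of S')) i j =
    (2^-1)%:C * Cintegral mu Omega0 g.
  have subE (X Y : 'M[C]_n) : (X - Y) i j = X i j - Y i j by rewrite !mxE.
  have GE := congr2 (fun a b => a - b) (GmxE (m_of S) i j) (GmxE (m_of S') i j).
  exact (etrans (subE _ _) (etrans GE (half_sub_Cintegral _ _ iS iS'))).
rewrite Normc.normcM normc_real ger0_norm ?invr_ge0// mulrC ler_pdivrMr// mulrC.
pose K := 2 * n%:R * k ^+ 2 / l * b.
have iK : mu.-integrable Omega0 (EFin \o (fun xi => K * dominator xi)).
  rewrite (_ : _ \o _ = (fun xi => K%:E * (EFin \o dominator) xi)%E).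
    by apply: integrableZl => //; exact: integrable_dominator.
  by apply/funext => xi /=; rewrite EFinM.
rewrite -/K -RintegralZl//; last exact: integrable_dominator.
apply: (normc_Cintegral_le mu _ mOmega0 g) => //.
  apply: cmeasurableD; first exact: cmeasurable_outer.
  by apply: cmeasurableM; [exact: cmeasurable_cst|exact: cmeasurable_outer].
move=> xi _; rewrite /g mulN1r (le_trans (normc_outer_dist _ _ _ _))//.
have kS := norm1_residual S l a l0 Sl a0 Sa xi.
have kS' := norm1_residual S' l a l0 S'l a0 S'a xi.
have dist : norm1 (res S xi - res S' xi) <= n%:R * b / l * norm1 (res S xi).
  apply: (wcoef_residual_dist (regularized delta S) (regularized delta S')) => // i' j'.
  by rewrite /regularized opprD addrACA subrr add0r.
have t0 : 0 <= n%:R * b / l by rewrite !mulr_ge0 ?invr_ge0// ltW.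
exact (product_bound _ _ _ _ _ _ _ _ t0 (norm1_ge0 _) (norm1_ge0 _) (norm1_ge0 _) dist kS kS').
Qed.

End residual_integrals.


(** * Contractions on a compact set of matrices *)

Section geometric_decay.
Context {R : realType}.
Implicit Types (q c e : R).

Lemma geometric_small q c e : 0 <= q -> q < 1 -> 0 < e ->
  exists N, forall k, (N <= k)%N -> q ^+ k * c < e.
Proof.
move=> q0 q1 e0; have : (fun k => c * q ^+ k) @ \oo --> (0 : R).
  by apply: cvg_geometric; rewrite ger0_norm.
move=> /cvgrPdist_lt/(_ e e0)[N _ hN]; exists N => k Nk.
have := hN k Nk; rewrite /= sub0r normrN => h.
by rewrite mulrC (le_lt_trans (ler_norm _)).
Qed.

Lemma cvg0_nonneg (u : nat -> R) : (forall k, 0 <= u k) ->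
  (forall e, 0 < e -> exists N, forall k, (N <= k)%N -> u k < e) ->
  u @ \oo --> (0 : R).
Proof.
move=> u0 ue; apply/cvgrPdist_lt => e e0; have [N hN] := ue e e0.
by exists N => // k Nk; rewrite /= sub0r normrN ger0_norm ?hN.
Qed.

(** [n] is the dimension, [dm] an upper bound of delta, [r] a bound of the norms
    in [W] and [I] the integral of the dominating function; the entries of
    [delta I + S] are then at most [dm + r]. Adding 1 makes the constant
    positive. *)
Definition fpi_constant (n dm r I : R) : R :=
  n ^+ 2 * (4 * n * (dm + 2 * n * (dm + r)) ^+ 2 * I) + 1.

Lemma fpi_constant_gt0 (n dm r I : R) : 0 <= n -> 0 <= I -> 0 < fpi_constant n dm r I.
Proof.
move=> n0 I0; apply: ltr_wpDl => //; apply: mulr_ge0; first exact: sqr_ge0.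
by apply: mulr_ge0 => //; apply: mulr_ge0; rewrite ?sqr_ge0 ?mulr_ge0.
Qed.

(** The left-hand side is the bound for the variation of [G] when
    [delta I + S] is bounded below by [delta / 2]; bounding delta by [dm] in the
    numerators leaves the power [- 3]. *)
Lemma fpi_constant_bound (n dm r de b I : R) :
  0 <= n -> 0 <= r -> 0 <= b -> 0 <= I -> 0 < de <= dm ->
  n ^+ 2 * (2 * n * (1 + n * (dm + r) / (de / 2)) ^+ 2 / (de / 2) * b * I) <=
  fpi_constant n dm r I / de ^+ 3 * b.
Proof.
move=> n0 r0 b0 I0 /andP[de0 dem]; set a := dm + r.
have a0 : 0 <= a by rewrite addr_ge0// (le_trans _ dem)// ltW.
have -> : n ^+ 2 * (2 * n * (1 + n * a / (de / 2)) ^+ 2 / (de / 2) * b * I) =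
    n ^+ 2 * (4 * n * (de + 2 * n * a) ^+ 2 * I) / de ^+ 3 * b.
  by field; rewrite gt_eqF.
apply: ler_wpM2r => //; apply: ler_wpM2r; first by rewrite invr_ge0 exprn_ge0// ltW.
apply: (@le_trans _ _ (n ^+ 2 * (4 * n * (dm + 2 * n * a) ^+ 2 * I))); last by rewrite lerDl.
apply: ler_wpM2l; first exact: sqr_ge0.
apply: ler_wpM2r => //; apply: ler_wpM2l; first by rewrite mulr_ge0.
have na0 : 0 <= 2 * n * a by rewrite !mulr_ge0.
by rewrite ler_sqr ?nnegrE ?addr_ge0 ?lerD2r// ?ltW// (lt_le_trans de0).
Qed.

End geometric_decay.

Section contraction_fixed_point.
Context {R : realType} {n : nat}.
Local Notation M := 'M[R[i]]_n.
Variables (W : set M) (c q : R) (Phi : M -> M).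
Hypotheses (W_compact : compact_mx W) (W_0 : W 0) (c0 : 0 <= c)
  (q0 : 0 <= q) (q1 : q < 1).
Let D (S : M) := W S /\ form_ge S (- c).
Hypotheses (Phi_D : forall S, D S -> D (Phi S))
  (Phi_contract : forall S S', D S -> D S' ->
     frob_norm (Phi S - Phi S') <= q * frob_norm (S - S')).

Lemma iter_contract Y S k : D Y -> Phi Y = Y -> D S ->
  frob_norm (iter k Phi S - Y) <= q ^+ k * frob_norm (S - Y).
Proof.
move=> DY fixY DS; elim: k => [|k IH]; first by rewrite expr0 mul1r.
have Dk : D (iter k Phi S) by elim: k {IH} => [|k IH]; [exact: DS|exact: Phi_D].
rewrite iterS -{1}fixY exprS -mulrA; apply: le_trans (Phi_contract _ _ Dk DY) _.
by rewrite ler_wpM2l.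
Qed.

Let three_eps (x a1 a2 a3 e : R) : x <= a1 + a2 + a3 -> a1 <= e / 3 -> a2 <= e / 3 ->
  a3 <= e / 3 -> x <= e.
Proof. lra. Qed.

(** Consecutive iterates of 0 become arbitrarily close, so a cluster point is
    fixed; it keeps the lower bound since that is a closed condition. *)
Lemma contraction_fixed_point : exists Y, D Y /\ Phi Y = Y.
Proof.
have D0 : D 0 by split=> //; apply: form_geW form_ge0mx; rewrite oppr_le0.
pose T k := iter k Phi 0.
have DT k : D (T k) by elim: k => [|k IH]; [exact: D0|exact: Phi_D].
have step k : frob_norm (T k.+1 - T k) <= q ^+ k * frob_norm (T 1%N - T 0%N).
  elim: k => [|k IH]; first by rewrite expr0 mul1r.
  rewrite exprS -mulrA; apply: le_trans (Phi_contract _ _ (DT k.+1) (DT k)) _.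
  by rewrite ler_wpM2l.
have [Y WY clY] := @compact_mx_cluster _ _ W T W_compact (fun k => (DT k).1).
have DY : D Y.
  split=> //; apply: form_ge_closed => e e0; have [k _ kY] := clY e e0 0%N.
  by exists (T k); [exact: (DT k).2|exact: ltW].
exists Y; split => //; apply/eqP; rewrite -subr_eq0; apply/eqP/frob_norm0_eq0.
apply/eqP; rewrite eq_le frob_norm_ge0 andbT; apply/ler_addgt0Pr => e e0; rewrite add0r.
have e3 : 0 < e / 3 by rewrite divr_gt0.
have [N hN] := geometric_small q (frob_norm (T 1%N - T 0%N)) (e / 3) q0 q1 e3.
have [k Nk kY] := clY _ e3 N.
have dPhi : frob_norm (Phi Y - T k.+1) <= e / 3.
  apply: le_trans (Phi_contract _ _ DY (DT k)) _; rewrite frob_distC.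
  by apply: le_trans (ltW kY); rewrite ler_piMl ?frob_norm_ge0// ltW.
have dstep : frob_norm (T k.+1 - T k) <= e / 3 := le_trans (step k) (ltW (hN k Nk)).
apply: (three_eps _ _ _ _ _ _ dPhi dstep (ltW kY)).
apply: le_trans (frob_dist_triangle (T k) _ _) _.
by rewrite lerD2r; exact: frob_dist_triangle.
Qed.

Lemma fixed_point_unique Y Z : D Y -> D Z -> Phi Y = Y -> Phi Z = Z -> Y = Z.
Proof.
move=> DY DZ fY fZ; have := Phi_contract _ _ DY DZ; rewrite fY fZ => h.
apply/eqP; rewrite -subr_eq0; apply/eqP/frob_norm0_eq0/eqP.
rewrite eq_le frob_norm_ge0 andbT.
have : (1 - q) * frob_norm (Y - Z) <= 0 by rewrite mulrBl mul1r subr_le0.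
by rewrite pmulr_rle0// subr_gt0.
Qed.

End contraction_fixed_point.

(** * The regularized fixed-point iteration *)

Section regularized_iteration.
Context {R : realType} {d n : nat}.
Local Notation C := R[i].
Local Notation normc := (@Normc.normc R).
Local Notation M := 'M[C]_n.
Variables (mu : {measure set 'rV[R]_d -> \bar R}) (Omega0 : set 'rV[R]_d).
Variables (alpha : R) (f : 'I_n -> 'rV[R]_d -> C).
Hypotheses (mOmega0 : measurable Omega0)
  (mf : forall i, cmeasurable_fun Omega0 (f i))
  (Df_L2 : forall i, in_L2 mu Omega0 (dilate alpha (f i))).
Variables (W : set M) (DW : set 'rV[R]_n).
Hypotheses (W_convex : convex_mx W) (W_compact : compact_mx W) (W_0 : W 0)
  (W_DW : W = [set X | exists v U,
     [/\ DW v, U \is unitarymx & X = U *m real_diag v *m U ^t*]])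
  (DW_convex : convex_rV DW) (DW_ortho : orthosymmetric DW).

Lemma eq_Gmx m m' : (forall xi, Omega0 xi -> m xi = m' xi) ->
  Gmx mu Omega0 alpha f m = Gmx mu Omega0 alpha f m'.
Proof.
move=> mm'; apply/matrixP => i j.
pose outer k xi := (residual alpha f k xi *m (residual alpha f k xi) ^t*) i j.
have E : Cintegral mu Omega0 (outer m) = Cintegral mu Omega0 (outer m').
  by apply: eq_Cintegral => xi Oxi; rewrite /outer /residual (mm' _ Oxi).
exact (etrans (GmxE mu Omega0 alpha f m i j) (etrans (congr1 (fun z => 2^-1 * z) E)
  (esym (GmxE mu Omega0 alpha f m' i j)))).
Qed.

Lemma normc_regularized (delta : R) (S : M) (r : R) i j : 0 <= delta -> frob_norm S <= r ->
  normc (regularized delta S i j) <= delta + r.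
Proof.
move=> d0 Sr; rewrite mxE; apply: le_trans (normcD _ _) _; apply: lerD.
  rewrite mxE; case: eqP => _; first by rewrite mulr1n normc_real ger0_norm.
  by rewrite mulr0n Normc.normc0.
exact: le_trans (normc_le_frob _ _ _) Sr.
Qed.

Variables (delta tauS tauG : R).
Hypotheses (delta0 : 0 < delta) (tauS0 : 0 < tauS) (tauG0 : 0 < tauG).

(** The iteration with [m] eliminated. *)
Definition step (S : M) : M :=
  S_update mu Omega0 alpha f tauS tauG W (m_update alpha f delta S) S.

Lemma S_update_step m S : (forall xi, Omega0 xi -> m xi = m_update alpha f delta S xi) ->
  S_update mu Omega0 alpha f tauS tauG W m S = step S.
Proof. by move=> h; rewrite /step /S_update (eq_Gmx _ _ h). Qed.

Lemma step_in S : W (step S).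
Proof. exact: (proj_in _ W_compact W_0). Qed.

(** [G] is positive semidefinite, so only the first term of
    [tauS S + tauG G] can be negative, and the projection keeps the bound. *)
Lemma step_form_ge S c l : 0 <= c -> form_ge S (- c) ->
  0 < l -> form_ge (regularized delta S) l -> form_ge (step S) (- (tauS * c)).
Proof.
move=> c0 Sc l0 Sl; apply: (form_ge_proj _ W_convex W_compact W_0 _ W_DW DW_convex DW_ortho).
  by rewrite mulr_ge0// ltW.
have -> : - (tauS * c) = tauS * (- c) + tauG * 0 by rewrite mulr0 addr0 mulrN.
apply: form_geD; first by apply: form_geZ Sc; exact: ltW.
apply: form_geZ; first exact: ltW.
apply: (Gmx_form_ge0 mu _ _ _ mOmega0 mf Df_L2 _ _ l (frob_norm (regularized delta S)) l0 Sl).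
  exact: frob_norm_ge0.
exact: normc_le_frob.
Qed.

(** On these matrices [delta I + S] is bounded below by [delta / 2], and the
    projection is nonexpansive. *)
Lemma step_contract (r dm : R) (I := \int[mu]_(xi in Omega0) dominator alpha f xi) :
  (forall X, W X -> frob_norm X <= r) -> delta <= dm ->
  forall S S', W S -> W S' ->
    form_ge S (- (delta / 2)) -> form_ge S' (- (delta / 2)) ->
    frob_norm (step S - step S') <=
    (tauS + fpi_constant n%:R dm r I * (tauG / delta ^+ 3)) * frob_norm (S - S').
Proof.
move=> Wr ddm S S' WS WS' Sd S'd.
have r0 : 0 <= r := le_trans (frob_norm_ge0 _) (Wr _ W_0).
have a0 : 0 <= dm + r by rewrite addr_ge0// (le_trans _ ddm)// ltW.
have ent (X : M) : W X -> forall i j, normc (regularized delta X i j) <= dm + r.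
  move=> WX i j; apply: le_trans (normc_regularized _ _ _ i j (ltW delta0) (Wr _ WX)) _.
  by rewrite lerD2r.
have d2 : 0 < delta / 2 by rewrite divr_gt0.
have hG := Gmx_dist mu _ _ _ mOmega0 mf Df_L2 _ S S' (delta / 2) (dm + r)
  (frob_norm (S - S')) d2 (form_ge_regularized_half _ _ Sd)
  (form_ge_regularized_half _ _ S'd) a0 (ent _ WS) (ent _ WS') (frob_norm_ge0 _)
  (normc_le_frob _).
have I0 : 0 <= I by apply: Rintegral_ge0 => xi _; exact: dominator_ge0.
have dd : 0 < delta <= dm by rewrite delta0.
have {}hG := le_trans hG
  (fpi_constant_bound _ _ _ _ _ _ (ler0n _ n) r0 (frob_norm_ge0 _) I0 dd).
apply: le_trans (proj_nonexpansive _ W_convex W_compact W_0 _ _) _.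
have split_arg (X X' G G' : M) :
    frob_norm (tauS%:C *: X + tauG%:C *: G - (tauS%:C *: X' + tauG%:C *: G')) <=
    tauS * frob_norm (X - X') + tauG * frob_norm (G - G').
  rewrite opprD addrACA -!scalerBr; apply: le_trans (frob_normD _ _) _.
  by rewrite !frob_normZ// ltW.
apply: le_trans (split_arg _ _ _ _) _.
rewrite mulrDl lerD2l.
set Cfpi := fpi_constant _ _ _ _.
have -> : Cfpi * (tauG / delta ^+ 3) * frob_norm (S - S') =
  tauG * (Cfpi / delta ^+ 3 * frob_norm (S - S')).
  by move: Cfpi (frob_norm _) => x y; ring.
by rewrite ler_pM2l.
Qed.

(** The initial weight is only known to be positive definite, which gives the
    bound [- delta]; each step multiplies it by [tauS]. The first step needs a
    separate argument for the lower bound of [delta I + S], later ones have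
    [tauS ^ k < 1]. *)
Lemma step_iterates_form_ge S0 (S : nat -> M) : tauS < 1 ->
  posdefmx (regularized delta S0) -> S 0%N = S0 -> (forall k, S k.+1 = step (S k)) ->
  forall k, form_ge (S k) (- (tauS ^+ k * delta)).
Proof.
move=> tauS1 S0pos SE0 SES; elim=> [|k IH].
  by rewrite expr0 mul1r SE0; exact: posdefmx_form_geN.
have tk0 : 0 < tauS ^+ k * delta by rewrite mulr_gt0// exprn_gt0.
have [l l0 Sl] : exists2 l, 0 < l & form_ge (regularized delta (S k)) l.
  case: k IH tk0 => [|k] IH tk0; first by rewrite SE0; exact: posdefmx_form_gt.
  exists (delta - tauS ^+ k.+1 * delta); last exact: form_ge_regularized IH.
  by rewrite subr_gt0 gtr_pMl// exprn_ilt1// ltW.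
by rewrite SES exprS -mulrA; exact: step_form_ge (ltW tk0) IH l0 Sl.
Qed.

(** The quotient at [xi] depends on the weight with a Lipschitz constant that
    blows up as [f xi] tends to 0; where [f xi = 0] all the quotients are 0. *)
Lemma m_update_cvg (S : nat -> M) (Y : M) xi :
  (forall k, form_ge (S k) (- (delta / 2))) -> form_ge Y (- (delta / 2)) ->
  frob_norm (S k - Y) @[k --> \oo] --> (0 : R) ->
  normc (m_update alpha f delta (S k) xi - m_update alpha f delta Y xi)
    @[k --> \oo] --> (0 : R).
Proof.
move=> Sd Yd SY; have d2 : 0 < delta / 2 by rewrite divr_gt0.
pose y := fvec f xi; pose x := Dfvec alpha f xi.
have mE X : m_update alpha f delta X xi = wcoef (regularized delta X) y x by [].
have [y0|y0] := eqVneq (norm1 y) 0.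
  have {}y0 : y = 0.
    apply/eqP; apply: contraT => /sqnorm_gt0; rewrite ltNge => /negP[].
    rewrite /sqnorm big1// => i _; apply/eqP; rewrite sqrf_eq0 eq_le normc_ge0 andbT.
    by rewrite -y0 normc_le_norm1.
  have z0 X : wcoef (regularized delta X) y x = 0.
    by rewrite /wcoef y0 /form_mx trmx0 map_mx0 !mul0mx !mxE mul0r.
  rewrite (_ : (fun k => _) = fun=> 0); first exact: cvg_cst.
  by apply/funext => k; rewrite !mE !z0 subrr Normc.normc0.
have ypos : 0 < norm1 y by rewrite lt_def y0 norm1_ge0.
pose K := n%:R / (delta / 2) * norm1 (x - wcoef (regularized delta Y) y x *: y) / norm1 y.
have bound k : normc (m_update alpha f delta (S k) xi - m_update alpha f delta Y xi) <=
    K * frob_norm (S k - Y).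
  rewrite !mE /K mulrAC ler_pdivlMr//.
  have YS i j : normc ((regularized delta Y - regularized delta (S k)) i j) <=
      frob_norm (S k - Y).
    rewrite frob_distC; apply: le_trans (normc_le_frob _ i j).
    by rewrite /regularized opprD addrACA subrr add0r.
  apply: le_trans (wcoef_dist _ _ _ _ y x d2 
    (form_ge_regularized_half _ _ Yd) (form_ge_regularized_half _ _ (Sd k)) (frob_norm_ge0 _) YS) _.
  by rewrite le_eqVlt; apply/orP; left; apply/eqP; move: (norm1 _) (frob_norm _) => p q; ring.
apply: (@squeeze_cvgr _ _ _ _ (fun=> 0) (fun k => K * frob_norm (S k - Y))).
- by near=> k; rewrite normc_ge0 bound.
- exact: cvg_cst.
- by rewrite -(mulr0 K); apply: cvgMr.
Unshelve. all: by end_near. Qed.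

End regularized_iteration.

(** Orbits enter the region where the step contracts, because their lower bounds
    decay like [tauS ^ k]; a fixed point is a constant orbit, hence lies there
    too, which gives uniqueness. *)
Lemma regularized_iteration_converges (R : realType) (d n : nat)
  (mu : {measure set 'rV[R]_d -> \bar R}) (Omega0 : set 'rV[R]_d) (alpha : R)
  (f : 'I_n -> 'rV[R]_d -> R[i]) (mOmega0 : measurable Omega0)
  (mf : forall i, cmeasurable_fun Omega0 (f i))
  (Df_L2 : forall i, in_L2 mu Omega0 (dilate alpha (f i)))
  (W : set 'M[R[i]]_n) (DW : set 'rV[R]_n)
  (W_herm : forall X, W X -> X \is hermsymmx)
  (W_convex : convex_mx W) (W_compact : compact_mx W) (W_0 : W 0)
  (W_DW : W = [set X | exists v U,
     [/\ DW v, U \is unitarymx & X = U *m real_diag v *m U ^t*]])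
  (DW_convex : convex_rV DW) (DW_ortho : orthosymmetric DW)
  (r dm : R) (Wr : forall X, W X -> frob_norm X <= r)
  (I := \int[mu]_(xi in Omega0) dominator alpha f xi)
  (delta tauS tauG : R) (delta0 : 0 < delta) (ddm : delta <= dm)
  (tauS0 : 0 < tauS) (tauG0 : 0 < tauG) (S0 : 'M[R[i]]_n)
  (S0pos : posdefmx (regularized delta S0))
  (q1 : tauS + fpi_constant n%:R dm r I * (tauG / delta ^+ 3) < 1) :
  converges_to_unique_fixed_point mu Omega0 alpha f delta tauS tauG W S0.
Proof.
set q := tauS + _ in q1.
have tail0 : 0 <= fpi_constant n%:R dm r I * (tauG / delta ^+ 3).
  have I0 : 0 <= I by apply: Rintegral_ge0 => xi _; exact: dominator_ge0.
  apply: mulr_ge0; first by apply: ltW; exact: fpi_constant_gt0.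
  by apply: divr_ge0; rewrite ?exprn_ge0// ltW.
have tauS1 : tauS < 1 by rewrite (le_lt_trans _ q1)// lerDl.
have q0 : 0 <= q by rewrite addr_ge0// ltW.
have d2 : 0 < delta / 2 by rewrite divr_gt0.
pose Phi := step mu Omega0 alpha f W delta tauS tauG.
pose D (S : 'M[R[i]]_n) := W S /\ form_ge S (- (delta / 2)).
have Phi_in S : W (Phi S) by exact: step_in.
have Phi_D S : D S -> D (Phi S).
  move=> [WS Sd]; split; first exact: Phi_in.
  have := step_form_ge mu _ _ _ mOmega0 mf Df_L2 _ _ W_convex W_compact W_0 W_DW
    DW_convex DW_ortho delta tauS tauG tauS0 tauG0 S _ _ (ltW d2) Sd d2 (form_ge_regularized_half _ _ Sd).
  by apply: form_geW; rewrite lerN2 ler_piMl// ltW.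
have Phi_q S S' : D S -> D S' -> frob_norm (Phi S - Phi S') <= q * frob_norm (S - S').
  move=> [WS Sd] [WS' S'd].
  exact: (step_contract mu _ _ _ mOmega0 mf Df_L2 _ W_convex W_compact W_0
    _ _ _ delta0 tauS0 tauG0 _ _ Wr ddm _ _ WS WS' Sd S'd).
have orbit_ge := step_iterates_form_ge mu _ _ _ mOmega0 mf Df_L2 _ _ W_convex W_compact
  W_0 W_DW DW_convex DW_ortho _ _ _ delta0 tauS0 tauG0.
(* the number of steps after which the lower bound - delta has been halved *)
have [Nh hNh] := geometric_small tauS delta (delta / 2) (ltW tauS0) tauS1 d2.
have orbit_D Z (S : nat -> 'M[R[i]]_n) : posdefmx (regularized delta Z) -> S 0%N = Z ->
    (forall k, S k.+1 = Phi (S k)) -> forall k, D (S (k + Nh.+1)%N).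
  move=> Zpos SZ SPhi k; split; first by rewrite addnS SPhi.
  apply: form_geW (orbit_ge _ _ tauS1 Zpos SZ SPhi _).
  by rewrite lerN2 ltW// hNh// (leq_trans (leqnSn _))// leq_addl.
have [Y [DY fixY]] := contraction_fixed_point W (delta / 2) q Phi W_compact W_0
  (ltW d2) q0 q1 Phi_D Phi_q.
have S_upd m S := S_update_step mu Omega0 alpha f W delta tauS tauG m S.
exists (m_update alpha f delta Y), Y; split.
- split; last by split=> //; exact (etrans (esym fixY) (esym (S_upd _ Y (fun _ _ => erefl)))).
  apply: (posdefmx_form_ge _ _ d2); last exact: form_ge_regularized_half DY.2.
  exact: hermsymmx_regularized (W_herm _ DY.1).
- move=> m' S' S'pos [m'E S'E].
  have fixS' : Phi S' = S' := etrans (esym (S_upd _ _ m'E)) (esym S'E).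
  have DS' : D S' by exact: (orbit_D S' (fun=> S') S'pos erefl (fun=> esym fixS') 0%N).
  have S'Y : S' = Y := fixed_point_unique W _ q Phi q1 Phi_q _ _ DS' DY fixS' fixY.
  by split=> [|xi Oxi]; [exact: S'Y|rewrite (m'E _ Oxi) S'Y].
- move=> m S [SE0 it].
  have SPhi k : S k.+1 = Phi (S k).
    have [mE SE] := it k; exact (etrans SE (S_upd _ _ mE)).
  have DS := orbit_D _ _ S0pos SE0 SPhi.
  have SiterE k : S (k + Nh.+1)%N = iter k Phi (S Nh.+1).
    by elim: k => // k IH; rewrite addSn SPhi IH.
  have cvS : frob_norm (S (k + Nh.+1)%N - Y) @[k --> \oo] --> (0 : R).
    apply: cvg0_nonneg => [k|e e0]; first exact: frob_norm_ge0.
    have [N hN] := geometric_small q (frob_norm (S Nh.+1 - Y)) e q0 q1 e0.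
    exists N => k Nk; apply: le_lt_trans (hN k Nk); rewrite SiterE.
    exact: (iter_contract W _ _ _ q0 Phi_D Phi_q _ _ k DY fixY (DS 0%N)).
  split; first by rewrite -(cvg_shiftn Nh.+1).
  move=> xi Oxi; rewrite -(cvg_shiftn Nh.+2).
  under eq_fun => k do rewrite addnS (it _).1//.
  exact: (m_update_cvg alpha f delta delta0 _ Y xi (fun k => (DS k).2) DY.2 cvS).
Qed.

Theorem theorem4p1 (R : realType) (d n : nat) (hd : (0 < d)%N)
  (u f : 'I_n -> 'rV[R]_d -> R[i])
  (u_L2 : forall i, in_L2 (lebesgue_rV d) setT (u i))
  (u_indep : L2_linearly_independent u)
  (u_supp : forall i, supported_in (@unit_cube R d) (u i))
  (f_fourier : forall i, f i = fourier (u i))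
  (Omega0 : set 'rV[R]_d) (Omega0_compact : compact Omega0)
  (Omega0_interior : interior Omega0 !=set0)
  (alpha : R) (alpha_gt1 : 1 < alpha)
  (mu : {measure set 'rV[R]_d -> \bar R}) (cmu Cmu : R)
  (cmu_gt0 : 0 < cmu) (Cmu_gt0 : 0 < Cmu)
  (mu_frame : forall c : 'I_n -> R[i],
     let v := fun xi => \sum_(i < n) c i * f i xi in
     (cmu%:E * sqr_L2norm (lebesgue_rV d) setT v <= sqr_L2norm mu setT v)%E /\
     (sqr_L2norm mu setT v <= Cmu%:E * sqr_L2norm (lebesgue_rV d) setT v)%E)
  (Df_L2 : forall i, in_L2 mu Omega0 (dilate alpha (f i)))
  (W : set 'M[R[i]]_n) (DW : set 'rV[R]_n)
  (W_herm : forall X, W X -> X \is hermsymmx)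
  (W_convex : convex_mx W) (W_compact : compact_mx W) (W_0 : W 0)
  (W_unitary : unitarily_invariant W)
  (W_DW : W = [set X | exists v U,
     [/\ DW v, U \is unitarymx & X = U *m real_diag v *m U ^t*]])
  (DW_perm : perm_invariant DW) (DW_convex : convex_rV DW)
  (DW_ortho : orthosymmetric DW)
  (Sigma0 : 'M[R[i]]_n) (Sigma0_herm : Sigma0 \is hermsymmx)
  (trace_Sigma0 : ((complex.Re (\tr Sigma0))%:E <=
     ereal_sup [set (complex.Re (\tr X))%:E | X in W])%E)
  (trace_W : (ereal_sup [set (complex.Re (\tr X))%:E | X in W] < +oo)%E)
  (delta_max : R) :
  exists2 C_FPI : R, 0 < C_FPI &
    forall delta tauS tauG : R,
      0 < delta <= delta_max -> 0 < tauS -> 0 < tauG ->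
      posdefmx (regularized delta Sigma0) ->
      tauS + C_FPI * (tauG / delta ^+ 3) < 1 ->
      converges_to_unique_fixed_point mu Omega0 alpha f delta tauS tauG W Sigma0.
Proof.
have [r r0 Wr] := compact_mx_bounded W W_compact.
have mOmega0 : measurable Omega0.
  rewrite -(setCK Omega0); apply: measurableC; apply: sub_sigma_algebra.
  by apply: closed_openC; apply: compact_closed => //; exact: norm_hausdorff.
have mf i : cmeasurable_fun Omega0 (f i).
  have [[mRe mIm] _] := u_L2 i; rewrite f_fourier.
  have [fRe fIm] := cmeasurable_fourier d (u i) (conj mRe mIm).
  by split; exact: measurable_funTS.
set I := \int[mu]_(xi in Omega0) dominator alpha f xi.
have I0 : 0 <= I by apply: Rintegral_ge0 => xi _; exact: dominator_ge0.
exists (fpi_constant n%:R delta_max r I); first exact: fpi_constant_gt0.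
move=> delta tauS tauG /andP[delta0 deltam] tauS0 tauG0 S0pos q1.
exact: (regularized_iteration_converges R d n mu Omega0 alpha f mOmega0 mf Df_L2 W DW
  W_herm W_convex W_compact W_0 W_DW DW_convex DW_ortho r delta_max Wr
  delta tauS tauG delta0 deltam tauS0 tauG0 Sigma0 S0pos q1).
Qed.
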